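(* With $F$ as in the context, fix a set of primes $\mathcal{L}$. Let $U^\circ$ be a closed compact subgroup of $\mathcal{G}^\circ(\widehat{\mathbb{Q}}_\mathcal{L})$ such that: for every prime $\ell\in\mathcal{L}$, the projection of $U^\circ$ to $\mathcal{G}^\circ(\mathbb{Q}_\ell)$ is open in $\mathcal{G}^\circ(\mathbb{Q}_\ell)$; and for all but finitely many primes $\ell\in\mathcal{L}$, the projection of $U^\circ$ to $\mathcal{G}^\circ(\mathbb{Q}_\ell)$ is $\mathcal{G}^\circ(\mathbb{Z}_\ell)$. Then $U^\circ$ is open in $\mathcal{G}^\circ(\widehat{\mathbb{Q}}_\mathcal{L})$.
   Context: Let $f$ be a cuspidal vector-valued genus two Siegel modular eigenform of weight $(k_1,k_2)$, $k_1\ge k_2\ge2$, level $N$, character $\varepsilon$, whose associated cuspidal automorphic representation of $\mathrm{GSp}_4(\mathbb{A}_\mathbb{Q})$ has a functorial lift to $\mathrm{GL}_4(\mathbb{A}_\mathbb{Q})$ which exists, is cuspidal, and is neither an automorphic induction nor a symmetric cube lift. Let $a_p$ be the $T_p$-eigenvalues and $E=\mathbb{Q}(\{a_p:p\nmid N\},\varepsilon)\subset\mathbb{C}$. An inner twist is a pair $(\sigma,\chi)$, $\sigma\in\mathrm{Hom}(E,\mathbb{C})$, $\chi$ a Dirichlet character, with $\sigma(a_p)=\chi(p)a_p$ for all $p\nmid N$; the set $\Gamma$ of such $\sigma$ is a subgroup of $\mathrm{Aut}(E/\mathbb{Q})$, and $F=E^\Gamma$ with ring of integers $\mathcal{O}_F$.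 $\mathcal{G}^\circ$ is the group scheme over $\mathbb{Z}$ with $\mathcal{G}^\circ(R)=\mathrm{Sp}_4(\mathcal{O}_F\otimes_\mathbb{Z}R)$, where $\mathrm{Sp}_4(R)=\{g\in\mathrm{GL}_4(R):g^tJg=J\}$ for the standard antidiagonal symplectic form $J$. $\widehat{\mathbb{Q}}_\mathcal{L}=\mathbb{Q}\otimes_\mathbb{Z}\prod_{\ell\in\mathcal{L}}\mathbb{Z}_\ell$, so $\mathcal{G}^\circ(\widehat{\mathbb{Q}}_\mathcal{L})$ is the restricted product of the $\mathcal{G}^\circ(\mathbb{Q}_\ell)$ with respect to the $\mathcal{G}^\circ(\mathbb{Z}_\ell)$, with projections to each factor $\mathcal{G}^\circ(\mathbb{Q}_\ell)$. *)

(* Defs.v *)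
From HB Require Import structures.
From mathcomp Require Import all_boot all_order all_algebra all_field.
From mathcomp Require Import all_classical all_reals.
From mathcomp Require Import topology.
From mathcomp Require Import complex.

Set Implicit Arguments.
Unset Strict Implicit.
Unset Printing Implicit Defensive.

Import Order.TTheory GRing.Theory Num.Theory.

Local Open Scope classical_set_scope.
Local Open Scope ring_scope.
Local Open Scope quotient_scope.

Local Notation fext := functional_extensionality_dep.

Definition prod_ring (I : Type) (A : I -> comPzRingType) : Type :=
  forall i, A i.

Section ProdRing.
Variables (I : Type) (A : I -> comPzRingType).
Local Notation P := (prod_ring A).

HB.instance Definition _ := gen_eqMixin P.
HB.instance Definition _ := gen_choiceMixin P.

Let addf (x y : P) : P := fun i => x i + y i.
Let oppf (x : P) : P := fun i => - x i.
Let zerof : P := fun i => 0.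
Let mulf (x y : P) : P := fun i => x i * y i.
Let onef : P := fun i => 1.

Let addfA : associative addf.
Proof. by move=> x y z; apply: fext => i; exact: addrA. Qed.
Let addfC : commutative addf.
Proof. by move=> x y; apply: fext => i; exact: addrC. Qed.
Let add0f : left_id zerof addf.
Proof. by move=> x; apply: fext => i; exact: add0r. Qed.
Let addNf : left_inverse zerof oppf addf.
Proof. by move=> x; apply: fext => i; exact: addNr. Qed.
HB.instance Definition _ := GRing.isZmodule.Build P addfA addfC add0f addNf.

Let mulfA : associative mulf.
Proof. by move=> x y z; apply: fext => i; exact: mulrA. Qed.
Let mulfC : commutative mulf.
Proof. by move=> x y; apply: fext => i; exact: mulrC. Qed.
Let mul1f : left_id onef mulf.
Proof. by move=> x; apply: fext => i; exact: mul1r. Qed.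
Let mulfDl : left_distributive mulf addf.
Proof. by move=> x y z; apply: fext => i; exact: mulrDl. Qed.
HB.instance Definition _ :=
  GRing.Zmodule_isComPzRing.Build P mulfA mulfC mul1f mulfDl.

End ProdRing.

(* Tensor products of commutative rings over Z: formal finite sums of pure    *)
(* tensors, identified when every biadditive map agrees on them.              *)

Definition biadditive (A B M : zmodType) (f : A -> B -> M) : Prop :=
  (forall a a' b, f (a + a') b = f a b + f a' b) /\
  (forall a b b', f a (b + b') = f a b + f a b').

Section Tensor.
Variables A B : comPzRingType.
Local Notation pre := (seq (A * B)).

Definition tens_eval (M : zmodType) (f : A -> B -> M) (s : pre) : M :=
  \sum_(u <- s) f u.1 u.2.

Definition tens_equiv (s t : pre) : bool :=
  `[< forall (M : zmodType) (f : A -> B -> M),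
        biadditive f -> tens_eval f s = tens_eval f t >].

Let tens_equiv_refl : reflexive tens_equiv.
Proof. by move=> s; apply/asboolP. Qed.
Let tens_equiv_sym : symmetric tens_equiv.
Proof. by move=> s t; apply/asboolP/asboolP => h M f hf; rewrite h. Qed.
Let tens_equiv_trans : transitive tens_equiv.
Proof.
move=> t s u /asboolP st /asboolP tu.
by apply/asboolP => M f hf; rewrite st // tu.
Qed.

Canonical tens_equivRel :=
  EquivRel tens_equiv tens_equiv_refl tens_equiv_sym tens_equiv_trans.

Definition tens : Type := {eq_quot tens_equiv}.
HB.instance Definition _ : EqQuotient _ tens_equiv tens := EqQuotient.on tens.
HB.instance Definition _ := Choice.on tens.

Definition pure (a : A) (b : B) : tens := \pi_tens [:: (a, b)].

Definition tens_lift (M : zmodType) (f : A -> B -> M) (t : tens) : M :=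
  tens_eval f (repr t).

Lemma tens_eqP (s t : pre) :
  \pi_tens s = \pi_tens t <->
  forall (M : zmodType) (f : A -> B -> M),
    biadditive f -> tens_eval f s = tens_eval f t.
Proof.
split=> [/eqP|h]; first by rewrite piE => /asboolP.
by apply/eqP; rewrite piE; apply/asboolP.
Qed.

Lemma tens_liftE (M : zmodType) (f : A -> B -> M) (s : pre) :
  biadditive f -> tens_lift f (\pi_tens s) = tens_eval f s.
Proof. by move=> hf; apply: (proj1 (tens_eqP _ _) _ M f hf); rewrite reprK. Qed.

Lemma biadd0l (M : zmodType) (f : A -> B -> M) b : biadditive f -> f 0 b = 0.
Proof. by case=> h _; apply: (addrI (f 0 b)); rewrite -h !addr0. Qed.
Lemma biadd0r (M : zmodType) (f : A -> B -> M) a : biadditive f -> f a 0 = 0.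
Proof. by case=> _ h; apply: (addrI (f a 0)); rewrite -h !addr0. Qed.
Lemma biaddNl (M : zmodType) (f : A -> B -> M) a b :
  biadditive f -> f (- a) b = - f a b.
Proof.
move=> hf; apply: (addrI (f a b)).
by rewrite -(proj1 hf) !subrr biadd0l.
Qed.

Let addp (s t : pre) : pre := s ++ t.
Let oppp (s : pre) : pre := [seq (- u.1, u.2) | u <- s].
Let mulp (s t : pre) : pre := [seq (u.1 * v.1, u.2 * v.2) | u <- s, v <- t].

Let eval_add (M : zmodType) (f : A -> B -> M) s t :
  tens_eval f (addp s t) = tens_eval f s + tens_eval f t.
Proof. exact: big_cat. Qed.
Let eval_opp (M : zmodType) (f : A -> B -> M) s :
  biadditive f -> tens_eval f (oppp s) = - tens_eval f s.
Proof.
move=> hf; rewrite /tens_eval big_map /= -sumrN.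
by apply: eq_bigr => u _; rewrite biaddNl.
Qed.
Let eval_mul (M : zmodType) (f : A -> B -> M) s t :
  tens_eval f (mulp s t) =
  tens_eval (fun a b => tens_eval (fun a' b' => f (a * a') (b * b')) t) s.
Proof. by rewrite /tens_eval big_allpairs_dep. Qed.
Let eval_mulC (M : zmodType) (f : A -> B -> M) s t :
  tens_eval f (mulp s t) = tens_eval f (mulp t s).
Proof.
rewrite !eval_mul /tens_eval exchange_big /=; apply: eq_bigr => u _.
by apply: eq_bigr => v _; rewrite mulrC [v.2 * _]mulrC.
Qed.
Let biadd_mul (M : zmodType) (f : A -> B -> M) (a : A) (b : B) :
  biadditive f -> biadditive (fun a' b' => f (a * a') (b * b')).
Proof. by move=> [h1 h2]; split=> *; rewrite mulrDr ?h1 ?h2. Qed.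

Let addt (x y : tens) : tens := \pi_tens (addp (repr x) (repr y)).
Let oppt (x : tens) : tens := \pi_tens (oppp (repr x)).
Let mult (x y : tens) : tens := \pi_tens (mulp (repr x) (repr y)).

Let eval_repr (M : zmodType) (f : A -> B -> M) s :
  biadditive f -> tens_eval f (repr (\pi_tens s)) = tens_eval f s.
Proof. exact: tens_liftE. Qed.

Let eval_mulr (M : zmodType) (f : A -> B -> M) s t t' :
  biadditive f ->
  (forall (M' : zmodType) (f' : A -> B -> M'), biadditive f' ->
     tens_eval f' t = tens_eval f' t') ->
  tens_eval f (mulp s t) = tens_eval f (mulp s t').
Proof.
move=> hf h; rewrite !eval_mul; apply: eq_bigr => u _ /=.
by apply: h; exact: biadd_mul.
Qed.

Let pi_addt s t : addt (\pi_tens s) (\pi_tens t) = \pi_tens (addp s t).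
Proof. by apply/tens_eqP => M f hf; rewrite !eval_add !eval_repr. Qed.
Let pi_oppt s : oppt (\pi_tens s) = \pi_tens (oppp s).
Proof. by apply/tens_eqP => M f hf; rewrite !eval_opp // eval_repr. Qed.
Let pi_mult s t : mult (\pi_tens s) (\pi_tens t) = \pi_tens (mulp s t).
Proof.
apply/tens_eqP => M f hf.
rewrite (@eval_mulr _ _ _ _ t) //; last by move=> *; rewrite eval_repr.
rewrite eval_mulC (@eval_mulr _ _ _ _ s) //.
by move=> *; rewrite eval_repr.
Qed.

Let zerot : tens := \pi_tens [::].
Let onet : tens := pure 1 1.

Let addtA : associative addt.
Proof.
move=> x y z; apply/tens_eqP => M f hf; rewrite /addt.
by rewrite !(eval_add, eval_repr) // addrA.
Qed.
Let addtC : commutative addt.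
Proof. by move=> x y; apply/tens_eqP => M f hf; rewrite !eval_add addrC. Qed.
Let add0t : left_id zerot addt.
Proof. by move=> x; rewrite -[x]reprK pi_addt. Qed.
Let addNt : left_inverse zerot oppt addt.
Proof.
move=> x; rewrite -[x]reprK pi_oppt pi_addt; apply/tens_eqP => M f hf.
by rewrite eval_add eval_opp // addNr /tens_eval big_nil.
Qed.
HB.instance Definition _ := GRing.isZmodule.Build tens addtA addtC add0t addNt.

Let multA : associative mult.
Proof.
move=> x y z.
have -> : mult x (mult y z) = \pi_tens (mulp (repr x) (mulp (repr y) (repr z))).
  by rewrite -pi_mult reprK.
have -> : mult (mult x y) z = \pi_tens (mulp (mulp (repr x) (repr y)) (repr z)).
  by rewrite -pi_mult reprK.
apply/tens_eqP => M f hf; rewrite !eval_mul /tens_eval.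
apply: eq_bigr => u _; rewrite !big_allpairs_dep /=.
apply: eq_bigr => v _; apply: eq_bigr => w _ /=.
by rewrite !mulrA.
Qed.
Let multC : commutative mult.
Proof. by move=> x y; apply/tens_eqP => M f hf; exact: eval_mulC. Qed.
Let mul1t : left_id onet mult.
Proof.
move=> x; rewrite -[x]reprK pi_mult; apply/tens_eqP => M f hf.
rewrite eval_mul {1}/tens_eval big_seq1 /=.
by apply: eq_bigr => u _; rewrite !mul1r.
Qed.
Let multDl : left_distributive mult addt.
Proof.
move=> x y z; rewrite -[x]reprK -[y]reprK -[z]reprK.
rewrite pi_addt !pi_mult pi_addt.
apply/tens_eqP => M f hf.
by rewrite eval_add !eval_mul /tens_eval big_cat.
Qed.
HB.instance Definition _ :=
  GRing.Zmodule_isComPzRing.Build tens multA multC mul1t multDl.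

Lemma tens_piD s t : \pi_tens s + \pi_tens t = \pi_tens (s ++ t).
Proof. exact: pi_addt. Qed.
Lemma tens_piM s t : \pi_tens s * \pi_tens t =
  \pi_tens [seq (u.1 * v.1, u.2 * v.2) | u <- s, v <- t].
Proof. exact: pi_mult. Qed.
Lemma tens_pi1 : 1 = pure 1 1. Proof. by []. Qed.

Lemma tens_liftB (M : zmodType) (f : A -> B -> M) :
  biadditive f -> zmod_morphism (tens_lift f).
Proof.
move=> hf x y.
have hD u v : tens_lift f (u + v) = tens_lift f u + tens_lift f v.
  rewrite -[u]reprK -[v]reprK tens_piD !tens_liftE //; exact: big_cat.
by apply: (addIr (tens_lift f y)); rewrite -hD !subrK.
Qed.

Lemma tens_lift_monoid (S : comPzRingType) (f : A -> B -> S) :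
  biadditive f -> f 1 1 = 1 ->
  (forall a a' b b', f (a * a') (b * b') = f a b * f a' b') ->
  monoid_morphism (tens_lift f).
Proof.
move=> hf f1 fM; split.
  by rewrite tens_pi1 tens_liftE // /tens_eval big_seq1.
move=> x y; rewrite -[x]reprK -[y]reprK tens_piM !tens_liftE //.
rewrite /tens_eval big_allpairs_dep big_distrl /=.
apply: eq_bigr => u _; rewrite big_distrr /=.
by apply: eq_bigr => v _; rewrite fM.
Qed.

Lemma biadditive_pure : biadditive pure.
Proof.
by split=> *; rewrite tens_piD; apply/tens_eqP => M f [h1 h2];
  rewrite /tens_eval !big_cons !big_nil /= !addr0.
Qed.

Lemma pure_mul a a' b b' : pure (a * a') (b * b') = pure a b * pure a' b'.
Proof. by rewrite /pure tens_piM. Qed.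

End Tensor.

(* a (x) b |-> a (x) f b *)
Definition tens_map (A B C : comPzRingType) (f : B -> C) :
    tens A B -> tens A C :=
  tens_lift (fun a b => pure a (f b)).

Section TensMap.
Variables (A B C : comPzRingType) (f : {rmorphism B -> C}).

Lemma tens_map_biadd : biadditive (fun a b => pure a (f b) : tens A C).
Proof.
have [h1 h2] := biadditive_pure A C.
by split=> *; rewrite ?rmorphD ?h1 ?h2.
Qed.

HB.instance Definition _ := GRing.isZmodMorphism.Build (tens A B) (tens A C)
  (tens_map f) (tens_liftB tens_map_biadd).

Let tens_map_monoid : monoid_morphism (@tens_map A B C f).
Proof.
apply: (tens_lift_monoid tens_map_biadd); first by rewrite rmorph1 -tens_pi1.
by move=> *; rewrite rmorphM pure_mul.
Qed.
HB.instance Definition _ := GRing.isMonoidMorphism.Build (tens A B) (tens A C)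
  (tens_map f) tens_map_monoid.

End TensMap.

(* p-adic integers, as the inverse limit of the rings Z/p^(n+1). *)

Definition prime_number : Type := {p : nat | prime p}.
HB.instance Definition _ := Choice.on prime_number.
HB.instance Definition _ := isPointed.Build prime_number (exist _ 2%N isT).

Section Padic.
Variable l : prime_number.
Local Notation p := (val l).

Lemma Zpow_gt1 n : (1 < p ^ n.+1)%N.
Proof. by rewrite -{1}(exp1n n.+1) ltn_exp2r // prime_gt1 ?(valP l). Qed.

Definition Zpow (n : nat) : comNzRingType := 'Z_(p ^ n.+1).

Definition coherent : {pred prod_ring Zpow} :=
  fun x => `[< forall n : nat, (x n.+1 : nat)%:R = x n >].

Let redE n (k : nat) : ((k %% p ^ n.+2)%N)%:R = k%:R :> Zpow n.
Proof.
rewrite -(Zp_nat_mod (Zpow_gt1 n)) modn_dvdm ?Zp_nat_mod ?Zpow_gt1 //.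
by rewrite dvdn_exp2l.
Qed.

Let valZ n (x : Zpow n) : (x : nat)%:R = x :> Zpow n.
Proof. exact: natr_Zp. Qed.

Let val_natr n (k : nat) : ((k%:R%R : Zpow n) : nat) = (k %% p ^ n.+1)%N.
Proof. by rewrite val_Zp_nat ?Zpow_gt1. Qed.

Let redD n (x y : Zpow n.+1) :
  (((x + y)%R : Zpow n.+1) : nat)%:R = (x : nat)%:R + (y : nat)%:R :> Zpow n.
Proof.
have -> : x + y = ((x : nat) + (y : nat))%:R by rewrite natrD !valZ.
by rewrite val_natr redE natrD.
Qed.
Let redM n (x y : Zpow n.+1) :
  (((x * y)%R : Zpow n.+1) : nat)%:R = (x : nat)%:R * (y : nat)%:R :> Zpow n.
Proof.
have -> : x * y = ((x : nat) * (y : nat))%:R by rewrite natrM !valZ.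
by rewrite val_natr redE natrM.
Qed.
Let red1 n : ((1%R : Zpow n.+1) : nat)%:R = 1 :> Zpow n.
Proof. by have := redE n 1; rewrite -val_natr. Qed.
Let redB n (x y : Zpow n.+1) :
  (((x - y)%R : Zpow n.+1) : nat)%:R = (x : nat)%:R - (y : nat)%:R :> Zpow n.
Proof. by apply: (addIr (y : nat)%:R); rewrite -redD !subrK. Qed.

Lemma coherent_subring : subring_closed coherent.
Proof.
split.
- by apply/asboolP => n; exact: red1.
- by move=> x y /asboolP hx /asboolP hy; apply/asboolP => n;
    rewrite redB hx hy.
- by move=> x y /asboolP hx /asboolP hy; apply/asboolP => n;
    rewrite redM hx hy.
Qed.
HB.instance Definition _ :=
  GRing.isSubringClosed.Build _ coherent coherent_subring.

Record Zp : Type := MkZp { Zp_val : prod_ring Zpow; _ : Zp_val \in coherent }.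
HB.instance Definition _ := [isSub for Zp_val].
HB.instance Definition _ := [Choice of Zp by <:].
HB.instance Definition _ :=
  GRing.SubChoice_isSubComPzRing.Build _ _ Zp (subringClosedP _).

Let Zp_coh (x : Zp) n : (val x n.+1 : nat)%:R = val x n :> Zpow n.
Proof. by case: x => x /= /asboolP h; exact: h. Qed.

Let Zp1_neq0 : 1 != 0 :> Zp.
Proof.
apply/eqP => /(congr1 (fun x : Zp => (val x 0%N : nat))) /eqP.
by rewrite rmorph1 rmorph0 /= ?modn_small // Zp_cast ?Zpow_gt1.
Qed.
HB.instance Definition _ := GRing.PzSemiRing_isNonZero.Build Zp Zp1_neq0.

Let Zp_coh_mod (x : Zp) m k :
  ((val x (m + k)%N : nat) %% p ^ m.+1)%N = (val x m : nat).
Proof.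
elim: k => [|k IH].
  by rewrite addn0 -val_natr valZ.
rewrite -IH addnS -(Zp_coh x (m + k)) val_natr modn_dvdm //.
by rewrite dvdn_exp2l // ltnS leq_addr.
Qed.

Let Zp_idomain : GRing.integral_domain_axiom Zp.
Proof.
move=> x y xy0; apply/negPn/negP; rewrite negb_or => /andP[x0 y0].
have ex (z : Zp) : z != 0 -> exists n, (val z n : nat) != 0%N.
  move=> z0; apply: contrapT => h; case/eqP: z0; apply: val_inj.
  apply: functional_extensionality_dep => n; apply: val_inj => /=.
  by apply/eqP/negPn/negP => h'; apply: h; exists n.
have [m hm] := ex x x0; have [n hn] := ex y y0.
pose N := (m + n).+1; pose u := (val x N : nat); pose v := (val y N : nat).
have hu : ~~ (p ^ m.+1 %| u)%N.
  by have := Zp_coh_mod x m n.+1; rewrite addnS /dvdn => ->.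
have hv : ~~ (p ^ n.+1 %| v)%N.
  by have := Zp_coh_mod y n m.+1; rewrite addnC addSn /dvdn => ->.
have huv : (p ^ N.+1 %| u * v)%N.
  have : (u * v)%:R = 0 :> Zpow N.
    rewrite natrM !valZ.
    by rewrite -[LHS]/(val (x * y) N) xy0.
  by move=> /(congr1 (fun z : Zpow N => (z : nat))); rewrite val_natr => /eqP.
have pp := valP l.
have [u0|u0] := posnP u; first by rewrite u0 dvdn0 in hu.
have [v0|v0] := posnP v; first by rewrite v0 dvdn0 in hv.
move: hu hv huv; rewrite !pfactor_dvdn ?muln_gt0 ?u0 ?v0 // lognM //.
rewrite -!ltnNge /N !ltnS => h1 h2; apply/negP; rewrite -ltnNge.
by rewrite ltnS (leq_trans (leq_add h1 h2)).
Qed.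

Let Zp_unit : {pred Zp} := fun x => `[< exists y, y * x = 1 >].
Let Zp_inv (x : Zp) : Zp := xget x [set y | y * x = 1].
Let Zp_mulV : {in Zp_unit, left_inverse 1 Zp_inv *%R}.
Proof.
move=> x /asboolP h; rewrite /Zp_inv; case: xgetP => // hn.
by case: h => y /hn.
Qed.
Let Zp_unitP (x y : Zp) : y * x = 1 -> Zp_unit x.
Proof. by move=> h; apply/asboolP; exists y. Qed.
Let Zp_inv_out : {in [predC Zp_unit], Zp_inv =1 id}.
Proof.
move=> x /negP h; rewrite /Zp_inv; case: xgetP => // y _ hy.
by case: h; apply/asboolP; exists y.
Qed.
HB.instance Definition _ :=
  GRing.ComNzRing_hasMulInverse.Build Zp Zp_mulV Zp_unitP Zp_inv_out.
HB.instance Definition _ := GRing.ComUnitRing_isIntegral.Build Zp Zp_idomain.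

Definition Qp : Type := {fraction Zp}.
HB.instance Definition _ := GRing.Field.on Qp.

Definition Zp_to_Qp : Zp -> Qp := @tofrac Zp.
HB.instance Definition _ := GRing.RMorphism.on Zp_to_Qp.

(* The p-adic topology: x + p^n Z_p is a neighbourhood basis of x. *)
Definition Qp_open : set (set Qp) :=
  [set U | forall x, U x ->
     exists n : nat, forall z : Zp, U (x + p%:R ^+ n * Zp_to_Qp z)].

Let Qp_openT : Qp_open setT.
Proof. by move=> x _; exists 0%N. Qed.
Let Qp_openI : setI_closed Qp_open.
Proof.
move=> U V oU oV x [/oU[m hm] /oV[n hn]]; exists (m + n)%N => z; split.
- have := hm (p%:R ^+ n * z).
  by rewrite rmorphM rmorphXn rmorph_nat mulrA -exprD.
- have := hn (p%:R ^+ m * z).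
  by rewrite rmorphM rmorphXn rmorph_nat mulrA -exprD addnC.
Qed.
Let Qp_open_bigU (I : Type) (f : I -> set Qp) :
  (forall i, Qp_open (f i)) -> Qp_open (\bigcup_i f i).
Proof.
by move=> h x [i _ fix_]; have [n hn] := h i x fix_; exists n => z; exists i.
Qed.
HB.instance Definition _ :=
  isOpenTopological.Build Qp Qp_openT Qp_openI Qp_open_bigU.

Lemma Qp_intr_eq0 (z : int) : (z%:~R == 0 :> Qp) = (z == 0).
Proof.
have natr0 (k : nat) : k%:R = 0 :> Zp -> k = 0%N.
  move=> h; apply/eqP/negPn/negP; rewrite -lt0n => k0.
  have : (p ^ (logn p k).+1 %| k)%N.
    have := congr1 (fun x : Zp => val x (logn p k)) h.
    rewrite rmorph_nat rmorph0 => h'.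
    have e n j : (j%:R : prod_ring Zpow) n = j%:R.
      by elim: j => // j IH; rewrite [in RHS]mulrS -IH mulrS.
    by move: h'; rewrite e => /(congr1 (fun z : Zpow _ => (z : nat)));
      rewrite val_natr => /eqP.
  by rewrite pfactor_dvdn ?(valP l) // ltnn.
have natq (k : nat) : (k%:R == 0 :> Qp) = (k == 0%N).
  apply/eqP/eqP => [|-> //]; rewrite -(rmorph_nat Zp_to_Qp) => /eqP.
  by rewrite [_ == _]tofrac_eq0 => /eqP/natr0.
by case: z => k; rewrite ?NegzE ?mulrNz ?oppr_eq0 natq.
Qed.

Definition rat_to_Qp : rat -> Qp := ratr.

Let rat_to_Qp_zmod : zmod_morphism rat_to_Qp.
Proof.
have injZtoQ: @injective rat int intr by apply: intr_inj.
have nz_den x: (denq x)%:~R != 0 :> Qp by rewrite Qp_intr_eq0 denq_eq0.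
move=> x y.
apply: (canLR (mulfK (nz_den _))); apply: (mulIf (nz_den x)).
rewrite mulrAC mulrBl divfK ?nz_den // mulrAC -!rmorphM.
apply: (mulIf (nz_den y)); rewrite mulrAC mulrBl divfK ?nz_den //.
rewrite -!(rmorphM, rmorphB); congr _%:~R; apply: injZtoQ.
rewrite !(rmorphM, rmorphB) /= [_ - _]lock /= -lock !numqE.
by rewrite (mulrAC y) -!mulrBl -mulrA mulrAC !mulrA.
Qed.
Let rat_to_Qp_monoid : monoid_morphism rat_to_Qp.
Proof.
have injZtoQ: @injective rat int intr by apply: intr_inj.
have nz_den x: (denq x)%:~R != 0 :> Qp by rewrite Qp_intr_eq0 denq_eq0.
split=> [|x y]; first by rewrite /rat_to_Qp /ratr divr1.
rewrite /rat_to_Qp /ratr mulrC mulrAC.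
apply: canLR (mulKf (nz_den _)) _; rewrite !mulrA.
do 2!apply: canRL (mulfK (nz_den _)) _; rewrite -!rmorphM; congr _%:~R.
apply: injZtoQ; rewrite !rmorphM [x * y]lock /= !numqE -lock.
by rewrite -!mulrA mulrA mulrCA -!mulrA (mulrCA y).
Qed.
HB.instance Definition _ := GRing.isZmodMorphism.Build rat Qp rat_to_Qp
  rat_to_Qp_zmod.
HB.instance Definition _ := GRing.isMonoidMorphism.Build rat Qp rat_to_Qp
  rat_to_Qp_monoid.

End Padic.

Section RingOfIntegers.
Variable K : fieldExtType rat.

Definition integral_elt : {pred K} :=
  fun x => `[< integralOver (intr : int -> K) x >].

Lemma integral_elt_subring : subring_closed integral_elt.
Proof.
split; first by apply/asboolP; exact: integral1.
- move=> x y /asboolP hx /asboolP hy; apply/asboolP; exact: integral_sub.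
- move=> x y /asboolP hx /asboolP hy; apply/asboolP; exact: integral_mul.
Qed.
HB.instance Definition _ :=
  GRing.isSubringClosed.Build K integral_elt integral_elt_subring.

Record int_ring : Type := MkInt { int_val : K; _ : int_val \in integral_elt }.
HB.instance Definition _ := [isSub for int_val].
HB.instance Definition _ := [Choice of int_ring by <:].
HB.instance Definition _ := [SubChoice_isSubComNzRing of int_ring by <:].

End RingOfIntegers.

Section Symplectic.
Variable A : comPzRingType.

Definition sympJ : 'M[A]_4 :=
  \matrix_(i, j) if (i + j == 3)%N then (if (i < 2)%N then 1 else -1) else 0.

Definition in_GL4 (g : 'M[A]_4) : Prop :=
  exists h : 'M[A]_4, g *m h = 1%:M /\ h *m g = 1%:M.

Definition symplectic : {pred 'M[A]_4} :=
  fun g => `[< in_GL4 g /\ g^T *m sympJ *m g = sympJ >].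

Record Sp4 : Type := MkSp4 { Sp4_val :> 'M[A]_4; _ : Sp4_val \in symplectic }.
HB.instance Definition _ := [isSub for Sp4_val].
HB.instance Definition _ := [Choice of Sp4 by <:].

Lemma symplectic1 : 1%:M \in symplectic.
Proof.
apply/asboolP; split; first by exists 1%:M; rewrite mulmx1.
by rewrite trmx1 mul1mx mulmx1.
Qed.

Lemma symplecticM (g h : 'M[A]_4) :
  g \in symplectic -> h \in symplectic -> g *m h \in symplectic.
Proof.
move=> /asboolP[[g' [gg' g'g]] gJ] /asboolP[[h' [hh' h'h]] hJ].
apply/asboolP; split.
  exists (h' *m g'); split.
  - by rewrite mulmxA -[g *m h *m h']mulmxA hh' mulmx1.
  - by rewrite mulmxA -[h' *m g' *m g]mulmxA g'g mulmx1.
by rewrite trmx_mul -[RHS]hJ -[in RHS]gJ !mulmxA.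
Qed.

Definition mx_inv (g : 'M[A]_4) : 'M[A]_4 :=
  xget 1%:M [set h | g *m h = 1%:M /\ h *m g = 1%:M].

Lemma mx_invP (g : 'M[A]_4) :
  g \in symplectic -> g *m mx_inv g = 1%:M /\ mx_inv g *m g = 1%:M.
Proof.
by move=> /asboolP[[h hh] _]; rewrite /mx_inv; case: xgetP => // /(_ h).
Qed.

Lemma symplecticV (g : 'M[A]_4) : g \in symplectic -> mx_inv g \in symplectic.
Proof.
move=> hg; have [gg' g'g] := mx_invP hg; have /asboolP[_ gJ] := hg.
apply/asboolP; split; first by exists g.
rewrite -{1}gJ !mulmxA -trmx_mul gg' trmx1 mul1mx.
by rewrite -mulmxA gg' mulmx1.
Qed.

Let spP (g : Sp4) : val g \in symplectic := valP g.
Definition Sp4_one : Sp4 := MkSp4 symplectic1.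
Definition Sp4_mul (g h : Sp4) : Sp4 := MkSp4 (symplecticM (spP g) (spP h)).
Definition Sp4_inv (g : Sp4) : Sp4 := MkSp4 (symplecticV (spP g)).

Let Sp4_mulA : associative Sp4_mul.
Proof. by move=> x y z; apply: val_inj; exact: mulmxA. Qed.
Let Sp4_mul1g : left_id Sp4_one Sp4_mul.
Proof. by move=> x; apply: val_inj; exact: mul1mx. Qed.
Let Sp4_mulg1 : right_id Sp4_one Sp4_mul.
Proof. by move=> x; apply: val_inj; exact: mulmx1. Qed.
Let Sp4_mulVg : left_inverse Sp4_one Sp4_inv Sp4_mul.
Proof. by move=> x; apply: val_inj; have [] := mx_invP (spP x). Qed.
Let Sp4_mulgV : right_inverse Sp4_one Sp4_inv Sp4_mul.
Proof. by move=> x; apply: val_inj; have [] := mx_invP (spP x). Qed.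
HB.instance Definition _ :=
  isGroup.Build Sp4 Sp4_mulA Sp4_mul1g Sp4_mulg1 Sp4_mulVg Sp4_mulgV.

End Symplectic.

Section Sp4Map.
Variables (A B : comPzRingType) (f : {rmorphism A -> B}).

Lemma map_symplectic (g : Sp4 A) : map_mx f g \in @symplectic B.
Proof.
have fJ : map_mx f (sympJ A) = sympJ B.
  apply/matrixP => i j; rewrite !mxE; case: ifP => _; last exact: rmorph0.
  by case: ifP => _; rewrite ?rmorphN rmorph1.
case: g => g /= /asboolP[[h [gh hg]] gJ]; apply/asboolP; split.
  by exists (map_mx f h); rewrite -!map_mxM gh hg map_mx1.
have -> : (map_mx f g)^T = map_mx f g^T by apply/matrixP => i j; rewrite !mxE.
by rewrite -fJ -!map_mxM gJ.
Qed.

Definition Sp4_map (g : Sp4 A) : Sp4 B := MkSp4 (map_symplectic g).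

End Sp4Map.

(* The group scheme over Z whose R-points are Sp_4(O_K (x)_Z R). *)

Definition Gcirc (K : fieldExtType rat) (A : comPzRingType) : Type :=
  Sp4 (tens (int_ring K) A).
HB.instance Definition _ K A := Group.on (Gcirc K A).

Definition Gcirc_map (K : fieldExtType rat) (A B : comPzRingType)
  (f : {rmorphism A -> B}) : Gcirc K A -> Gcirc K B :=
  Sp4_map (tens_map f).

(* Local points. O_K (x) Q_l is a free Q_l-module of finite rank; its         *)
(* topology is the coarsest one for which the Q_l-linear extensions of all    *)
(* additive maps O_K -> Z are continuous, i.e. the product topology of Q_l^d  *)
(* for any Z-basis of O_K.                                                    *)

Section LocalPoints.
Variables (K : fieldExtType rat) (l : prime_number).

Definition KQ : Type := tens (int_ring K) (Qp l).
HB.instance Definition _ := GRing.ComPzRing.on KQ.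

Definition coord (lam : {additive int_ring K -> int}) : KQ -> Qp l :=
  tens_lift (fun (a : int_ring K) (x : Qp l) => x *~ lam a).

Definition KQ_subbase : set (set KQ) :=
  [set U | exists (lam : {additive int_ring K -> int}) (V : set (Qp l)),
     open V /\ U = coord lam @^-1` V].
HB.instance Definition _ := isSubBaseTopological.Build KQ KQ_subbase id.

Definition Gloc : Type := Sp4 KQ.
HB.instance Definition _ := Group.on Gloc.
HB.instance Definition _ := Topological.copy Gloc
  (initial_topology (val : Sp4 KQ -> 'M[KQ]_4)).

(* The image of the Z_l-points. *)
Definition Gloc_int : set Gloc :=
  range (Gcirc_map (K := K) (@Zp_to_Qp l) : Gcirc K (Zp l) -> Gloc).

End LocalPoints.
Arguments Gloc_int : clear implicits.

(* Gadele is the group of Q (x) prod_(l in L) Z_l-points. Under the family of *)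
(* projections (Gproj l)_l it is the restricted product of the Gloc K l with  *)
(* respect to the Gloc_int K l, and it carries the restricted product         *)
(* topology: the open boxes have Gloc_int as l-component for almost all l.    *)

Section AdelicPoints.
Variables (K : fieldExtType rat) (L : set prime_number).

Definition Zhat : comPzRingType := prod_ring (fun l : L => Zp (set_val l)).
Definition Qhat : comPzRingType := tens rat Zhat.

Section Projection.
Variable l : L.

Definition Qhat_proj : Qhat -> Qp (set_val l) :=
  tens_lift (fun (q : rat) (z : Zhat) =>
    rat_to_Qp (set_val l) q * Zp_to_Qp (z l)).

Let Qhat_proj_biadd : biadditive (fun (q : rat) (z : Zhat) =>
  rat_to_Qp (set_val l) q * Zp_to_Qp (z l)).
Proof.
split=> *; first by rewrite rmorphD mulrDl.
by rewrite [X in Zp_to_Qp X]/(_ + _) rmorphD mulrDr.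
Qed.
HB.instance Definition _ := GRing.isZmodMorphism.Build Qhat (Qp (set_val l))
  Qhat_proj (tens_liftB Qhat_proj_biadd).
Let Qhat_proj_monoid : monoid_morphism Qhat_proj.
Proof.
apply: (tens_lift_monoid Qhat_proj_biadd).
  by rewrite rmorph1 mul1r; exact: rmorph1.
move=> a a' b b'; rewrite rmorphM.
have -> : (b * b') l = b l * b' l by [].
by rewrite rmorphM mulrACA.
Qed.
HB.instance Definition _ := GRing.isMonoidMorphism.Build Qhat (Qp (set_val l))
  Qhat_proj Qhat_proj_monoid.

End Projection.

Definition Gadele : Type := Gcirc K Qhat.
HB.instance Definition _ := Group.on Gadele.

Definition Gproj (l : L) : Gadele -> Gloc K (set_val l) :=
  Gcirc_map (K := K) (Qhat_proj l).

Definition restricted_box : set (set Gadele) :=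
  [set B | exists W : forall l : L, set (Gloc K (set_val l)),
     [/\ forall l, open (W l),
         finite_set [set l | W l <> Gloc_int K (set_val l)] &
         B = [set g | forall l, W l (Gproj l g)]]].
HB.instance Definition _ := isSubBaseTopological.Build Gadele restricted_box id.

End AdelicPoints.

Definition is_subgroup (G : groupType) (U : set G) : Prop :=
  U 1%g /\ forall g h, U g -> U h -> U (g * h^-1)%g.

(* a p is meaningful only at the primes p not dividing N.                     *)
Section InnerTwists.
Variable C : fieldType.

Definition dirichlet_character (M : nat) (chi : nat -> C) : Prop :=
  [/\ (0 < M)%N, chi 1%N = 1, (forall m n, chi (m * n)%N = chi m * chi n),
      (forall n, chi (n + M)%N = chi n) &
      (forall n, chi n != 0 <-> coprime n M)].

Definition is_subfield (S : set C) : Prop :=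
  [/\ S 1, (forall x y, S x -> S y -> S (x - y)),
      (forall x y, S x -> S y -> S (x * y)) & (forall x, S x -> S x^-1)].

Definition generated_field (X : set C) : set C :=
  [set z | forall S, is_subfield S -> X `<=` S -> S z].

Definition coefficient_field (N : nat) (a eps : nat -> C) : set C :=
  generated_field ([set a p | p in [set p | prime p /\ ~~ (p %| N)%N]]
                   `|` range eps).

(* E is embedded in C by iota, so a p stands for its preimage x in E on the   *)
(* left-hand side of sigma(a_p) = chi(p) a_p.                                 *)
Definition inner_twist (N : nat) (a : nat -> C) (E : fieldExtType rat)
    (iota sigma : {rmorphism E -> C}) (chi : nat -> C) : Prop :=
  (exists M, dirichlet_character M chi) /\
  forall (p : nat) (x : E), prime p -> ~~ (p %| N)%N -> iota x = a p ->
    sigma x = chi p * a p.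

Definition inner_twist_group (N : nat) (a : nat -> C) (E : fieldExtType rat)
    (iota : {rmorphism E -> C}) : set {rmorphism E -> C} :=
  [set sigma | exists chi, inner_twist N a iota sigma chi].

End InnerTwists.

(* Main.v *)
(** For [l] in [L] let [N_l] be the group of elements of [G(Z_l)] which, extended
    by [1] at the other primes, lie in [U].  As [U] is closed it contains the
    product of the [N_l], so it suffices that every [N_l] is open and that almost
    all of them are [G(Z_l)].

    If [x], [y] in the [l]-component of [U] generate a pro-[l] group, then Sylow's
    theorem lifts them to elements of [U] whose [r]-components, [r <> l], generate
    up to a pro-[r] group a finite [l]-group of matrices over [F_r].  In such a
    group, of degree [N], any two [N!]-th powers commute, because a maximal abelian
    normal subgroup is diagonalisable and self-centralising.  Hence there is an [m],
    independent of [l], such that the commutator of lifts of [x ^+ m] and [y ^+ m]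
    has its [r]-component in a pro-[r] group for each [r <> l].  Raising it to powers
    tending to [1] in [Z_l] and to [0] in the other [Z_r], and passing to a limit in
    the compact group [U], one sees that the commutator of [x ^+ m] and [y ^+ m]
    lies in [N_l].  For [x] and [y] root elements this puts root subgroups of [Sp_4]
    in [N_l], and Gaussian elimination over [O (x) Z_l] concludes. *)

Require Import Defs.
From HB Require Import structures.
From mathcomp Require Import all_boot all_order all_algebra all_field.
From mathcomp Require Import all_classical all_reals.
From mathcomp Require Import topology.
From mathcomp Require Import complex.
From mathcomp Require Import all_fingroup all_solvable ring.

Set Implicit Arguments.
Unset Strict Implicit.
Unset Printing Implicit Defensive.

Import Order.TTheory GRing.Theory Num.Theory.

Local Open Scope classical_set_scope.
Local Open Scope ring_scope.
(* Not [zmodp.Zp]. *)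
Local Notation Zp := Defs.Zp.

(** * Integral bases of rings of integers *)

Section LatticeBasis.

(** The obstacle is that the components of [U] at different primes may be tied together: a lift to
    [U] of a local element is arbitrary at all other primes. The constants lost in killing the
    unwanted components must be units at almost all [l], whence the insistence on one [m] for all
    [l]. This [m] is the factorial of four times the rank of [O_F], the degree of the regular
    representation of [Sp_4 (O_F (x) F_r)], times one integer for each of the finitely many primes
    [r] where the projection is not [G(Z_r)]. At those primes the components need not even be
    integral, so there a power of each element is moved into a pro-[r] group by compactness alone.
    The other constant is 2, the coefficient in the commutator of two short root elements of [Sp_4].
    The pairs [x], [y] are short root elements whose roots add up to a long root: they generate a
    Heisenberg group, which is visibly pro-[l]. The remaining roots come from the fact that the
    projection of [U] normalises [N_l]. *)

Definition is_Zbasis (M : zmodType) (d : nat) (w : 'I_d -> M)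
    (lam : 'I_d -> {additive M -> int}) : Prop :=
  (forall x, x = \sum_i w i *~ lam i x) /\
  (forall i j, lam i (w j) = (i == j)%:R).

Lemma additive_gen (M : zmodType) (f : {additive M -> int}) :
  exists x0 : M, forall x, (f x0 %| f x)%Z.
Proof.
have [[x /eqP fx]|f0] := pselect (exists x, f x <> 0); last first.
  exists 0 => x; have -> : f x = 0; last exact: dvdz0.
  by apply: contrapT => h; apply: f0; exists x.
pose P n := `[< (0 < n)%N /\ exists y, f y = n%:Z >].
have exP : exists n, P n.
  exists `|f x|%N; apply/asboolP; split; first by rewrite absz_gt0.
  have [h|h] := lerP 0 (f x); first by exists x; rewrite gez0_abs.
  by exists (- x); rewrite raddfN /= -abszN gez0_abs // oppr_ge0 ltW.
have [n /asboolP[n0 [x0 fx0]] min_n] := ex_minnP exP.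
exists x0 => y; rewrite fx0; apply/dvdz_mod0P; apply: contrapT => /eqP r0.
have nz : n%:Z != 0 by rewrite eqz_nat -lt0n.
have r_ge0 := modz_ge0 (f y) nz.
have rn : (f y %% n)%Z < n%:Z by rewrite -[X in _ < X]gez0_abs ?ltz_mod.
have /min_n : P `|(f y %% n)%Z|%N.
  apply/asboolP; split; first by rewrite absz_gt0.
  exists (y - x0 *~ (f y %/ n)%Z); rewrite gez0_abs // raddfB raddfMz fx0.
  by rewrite mulrzz mulrC {1}(divz_eq (f y) n) addrAC subrr add0r.
by rewrite leqNgt -ltz_nat gez0_abs // rn.
Qed.

(** Elimination over [int], one functional at a time: on what the chosen vectors leave over, the new
    functional has a cyclic image, and a preimage of a generator gives the next vector. The
    statement is about a projection and not yet a basis, since the functionals seen so far need not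
    separate points. *)
Lemma Zbasis_extend (M : zmodType) (n : nat) (phi : 'I_n -> {additive M -> int}) :
  exists (d : nat) (w : 'I_d -> M) (lam : 'I_d -> {additive M -> int}),
    (forall x i, phi i (x - \sum_j w j *~ lam j x) = 0) /\
    (forall i j, lam i (w j) = (i == j)%:R).
Proof.
elim: n phi => [|n IH] phi.
  exists 0%N, (fun=> 0), (fun=> \0%R); split; first by move=> x [].
  by move=> [].
have [d [w [lam [pr dual]]]] := IH (fun i => phi (lift ord_max i)).
pose proj x := x - \sum_j w j *~ lam j x.
have projB : zmod_morphism proj.
  move=> x y; rewrite /proj (eq_bigr (fun j => w j *~ lam j x - w j *~ lam j y)).
    by rewrite sumrB !opprD !opprK addrACA.
  by move=> j _; rewrite raddfB mulrzBr.
have psiB : zmod_morphism (fun x => phi ord_max (proj x)).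
  by move=> x y; rewrite projB raddfB.
pose psi : {additive M -> int} := HB.pack (fun x => phi ord_max (proj x))
  (GRing.isZmodMorphism.Build _ _ _ psiB).
have lam_proj i x : lam i (proj x) = 0.
  rewrite raddfB raddf_sum (bigD1 i) //= raddfMz dual eqxx big1 ?addr0.
    by rewrite intz subrr.
  by move=> j ji; rewrite raddfMz dual eq_sym (negPf ji) mul0rz.
have projw j : proj (w j) = 0.
  rewrite /proj (bigD1 j) //= dual eqxx big1 ?addr0 ?subrr // => i ij.
  by rewrite dual (negPf ij).
have projK x : proj (proj x) = proj x.
  by rewrite {1}/proj big1 ?subr0 // => j _; rewrite lam_proj.
have [x0 gen_x0] := additive_gen psi.
have [psi0|c0] := eqVneq (psi x0) 0.
  exists d, w, lam; split=> // x i; case: (unliftP ord_max i) => [j|] ->.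
    exact: pr.
  by apply/eqP; have := gen_x0 x; rewrite psi0 dvd0z.
have quoB : zmod_morphism (fun x => (psi x %/ psi x0)%Z).
  move=> x y; apply: (mulIf c0).
  by rewrite mulrBl !divzK ?gen_x0 // raddfB.
pose quo : {additive M -> int} := HB.pack (fun x => (psi x %/ psi x0)%Z)
  (GRing.isZmodMorphism.Build _ _ _ quoB).
(* [proj x0] rather than [x0], so that the functionals already chosen vanish on it; dually, [quo]
   factors through [proj] and vanishes on every [w j]. *)
pose w' i := if unlift ord_max i is Some j then w j else proj x0.
pose lam' i := if unlift ord_max i is Some j then lam j else quo.
exists d.+1, w', lam'; split=> [x i|i j].
  have E : x - \sum_(j < d.+1) w' j *~ lam' j x
      = proj x - proj x0 *~ (psi x %/ psi x0)%Z.
    rewrite big_ord_recr /= /w' /lam' unlift_none opprD addrA; congr (_ - _ - _).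
    apply: eq_bigr => j _.
    have -> : widen_ord (leqnSn d) j = lift ord_max j.
      by apply: val_inj; rewrite /= /bump leqNgt ltn_ord.
    by rewrite liftK.
  rewrite E raddfB raddfMz; case: (unliftP ord_max i) => [k|] ->.
    by rewrite !pr mul0rz subrr.
  by rewrite -[phi _ (proj x)]/(psi x) mulrzz mulrC divzK ?gen_x0 // subrr.
rewrite /lam' /w'; case: (unliftP ord_max i) => [i'|] ->;
  case: (unliftP ord_max j) => [j'|] ->; rewrite ?liftK ?unlift_none.
- by rewrite dual (inj_eq lift_inj).
- by rewrite lam_proj eq_sym (negPf (neq_lift _ _)).
- by rewrite /= projw raddf0 div0z (negPf (neq_lift _ _)).
- by rewrite eqxx /= projK divzz c0.
Qed.

Lemma Zbasis_exists (M : zmodType) (n : nat) (phi : 'I_n -> {additive M -> int}) :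
  (forall x, (forall i, phi i x = 0) -> x = 0) ->
  exists (d : nat) (w : 'I_d -> M) (lam : 'I_d -> {additive M -> int}),
    is_Zbasis w lam.
Proof.
move=> phi0; have [d [w [lam [pr dual]]]] := Zbasis_extend phi.
exists d, w, lam; split=> // x; apply/eqP; rewrite -subr_eq0; apply/eqP.
by apply: phi0 => i; exact: pr.
Qed.

End LatticeBasis.

(** * The trace form of a number field *)

Section Trace.
Variables (K : fieldExtType rat) (n : nat) (b : n.+1.-tuple K).
Hypothesis basis_b : basis_of fullv b.

Let b_free : free b := basis_free basis_b.

Let coord_b v : v = \sum_i coord b i v *: b`_i.
Proof. exact: (coord_basis basis_b (memvf v)). Qed.

Definition regular_mx (x : K) : 'M[rat]_n.+1 :=
  \matrix_(i, j) coord b j (x * b`_i).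

Let regular_mxB : zmod_morphism regular_mx.
Proof. by move=> x y; apply/matrixP => i j; rewrite !mxE mulrBl raddfB. Qed.
HB.instance Definition _ := GRing.isZmodMorphism.Build K 'M[rat]_n.+1
  regular_mx regular_mxB.

Let regular_mx_monoid : monoid_morphism regular_mx.
Proof.
split=> [|x y]; apply/matrixP => i j; rewrite !mxE.
  by rewrite mul1r coord_free // eq_sym.
rewrite -mulrA mulrCA [in LHS](coord_b (x * b`_i)) mulr_sumr raddf_sum /=.
by apply: eq_bigr => k _; rewrite !mxE -scalerAr linearZ.
Qed.
HB.instance Definition _ := GRing.isMonoidMorphism.Build K 'M[rat]_n.+1
  regular_mx regular_mx_monoid.

Lemma regular_mxA (c : rat) : regular_mx c%:A = c%:M.
Proof.
apply/matrixP => i j; rewrite !mxE mulr_algl linearZ /= coord_free //.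
by rewrite mulr_natr eq_sym.
Qed.

Definition Tr (x : K) : rat := \tr (regular_mx x).

Lemma TrB : zmod_morphism Tr.
Proof. by move=> x y; rewrite /Tr !raddfB. Qed.
HB.instance Definition _ := GRing.isZmodMorphism.Build K rat Tr TrB.

Lemma TrZ c x : Tr (c *: x) = c * Tr x.
Proof.
by rewrite /Tr -mulr_algl rmorphM /= regular_mxA -mulmxE mul_scalar_mx mxtraceZ.
Qed.

Lemma Tr_nondegenerate x : (forall y, Tr (x * y) = 0) -> x = 0.
Proof.
move=> h; apply: contrapT => /eqP x0.
have := h x^-1; rewrite divff // /Tr rmorph1 mxtrace1 => /eqP.
by rewrite pnatr_eq0.
Qed.

Let int_alg (p : {poly int}) :
  map_poly (intr : int -> K) p = map_poly (in_alg K) (map_poly intr p).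
Proof.
rewrite -map_poly_comp; apply: eq_map_poly => z /=.
by rewrite scaler_int.
Qed.

Let regular_horner (p : {poly int}) x :
  regular_mx (map_poly intr p).[x] = horner_mx (regular_mx x) (map_poly intr p).
Proof.
rewrite -horner_map int_alg -map_poly_comp /horner_mx /horner_morph.
by congr horner; apply: eq_map_poly => c /=; rewrite regular_mxA.
Qed.

(** Over [algC] the trace is the sum of the eigenvalues of the regular matrix. These are roots of
    the monic integral equation of [x], so the trace is a rational algebraic integer. *)
Lemma Tr_integral (x : K) : x \in @integral_elt K -> exists z : int, Tr x = z%:~R.
Proof.
move=> /asboolP[p p_monic /rootP px].
pose A := map_mx (ratr : rat -> algC) (regular_mx x).
have A0 : horner_mx A (map_poly intr p) = 0.
  have := regular_horner p x; rewrite px raddf0.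
  move/(congr1 (map_mx (ratr : rat -> algC))).
  rewrite map_mx0 map_horner_mx -map_poly_comp => ->.
  by congr horner_mx; apply: eq_map_poly => z /=; rewrite ratr_int.
have Aint_eig r : root (char_poly A) r -> r \in Aint.
  rewrite -eigenvalue_root_char => /eigenvalueP[v vA v0].
  have : root (map_poly intr p) r.
    have : v *m horner_mx A (map_poly intr p) = (map_poly intr p).[r] *: v.
      elim/poly_ind: (map_poly intr p) => [|q c IH].
        by rewrite raddf0 horner0 mulmx0 scale0r.
      rewrite rmorphD rmorphM /= horner_mx_X horner_mx_C hornerMXaddC.
      rewrite mulmxDr mulmxA IH -scalemxAl vA scalerA scalerDl.
      by rewrite mul_mx_scalar.
    rewrite A0 mulmx0 => /esym/eqP; rewrite scaler_eq0 (negPf v0) orbF.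
    by rewrite /root.
  move/root_monic_Aint; apply; first by rewrite monic_map.
  by apply/polyOverP => i; rewrite coef_map /= rpred_int.
have [rs rsE] := closed_field_poly_normal (char_poly A).
rewrite (monicP (char_poly_monic A)) scale1r in rsE.
have size_rs : size rs = n.+1.
  by have := size_char_poly A; rewrite rsE size_prod_XsubC => -[].
have trA : ratr (Tr x) = \sum_(r <- rs) r :> algC.
  have := coefPn_prod_XsubC (ps := rs); rewrite size_rs -rsE /= => /(_ isT).
  rewrite -[n in X in _`_X]/(n.+1.-1) char_poly_trace // => /oppr_inj <-.
  by rewrite /Tr /A trace_map_mx.
have : ratr (Tr x) \in Aint.
  rewrite trA big_seq; apply: rpred_sum => r rs_r; apply: Aint_eig.
  by rewrite rsE root_prod_XsubC.
move/(Cint_rat_Aint (Crat_rat _)); rewrite Cint_rat => /intrP[z ->].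
by exists z.
Qed.

(** Once [N] clears the denominators of the regular matrix, the characteristic polynomial of the
    resulting integral matrix annihilates [N * x], by Cayley-Hamilton and the injectivity of
    [regular_mx]. *)
Lemma integral_multiple (x : K) :
  exists2 N : nat, (0 < N)%N & N%:R * x \in @integral_elt K.
Proof.
pose den i j := `|denq (regular_mx x i j)|%N.
pose N := (\prod_i \prod_j den i j)%N.
have N0 : (0 < N)%N.
  by rewrite prodn_gt0 // => i; rewrite prodn_gt0 // => j; rewrite absz_gt0 denq_neq0.
exists N => //; apply/asboolP.
have /choice[B HB] : forall ij : 'I_n.+1 * 'I_n.+1, exists z : int,
    N%:R * regular_mx x ij.1 ij.2 = z%:~R.
  move=> [i j] /=.
  have /dvdnP[k kE] : (den i j %| N)%N.
    by rewrite /N (bigD1 i) //= (bigD1 j) //= -mulnA dvdn_mulr.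
  exists (k%:Z * numq (regular_mx x i j)).
  rewrite kE natrM -mulrA rmorphM /=; congr (_ * _).
  rewrite numqE mulrC; congr (_ * _).
  by rewrite /den -[X in _ = X%:~R]gez0_abs // ltW.
pose Bm := \matrix_(i, j) B (i, j).
exists (char_poly Bm); first exact: char_poly_monic.
apply/rootP; apply: (fmorph_inj regular_mx).
rewrite rmorph0 /= regular_horner.
have -> : regular_mx (N%:R * x) = map_mx intr Bm.
  rewrite rmorphM /= rmorph_nat mulr_natl; apply/matrixP => i j.
  by rewrite mulmxnE [RHS]mxE [in RHS]mxE -HB mulr_natl.
by rewrite -map_horner_mx Cayley_Hamilton map_mx0.
Qed.

(* The trace form embeds [O_K] in [Z^n]. *)
Lemma int_ring_Zbasis_of : exists (d : nat) (w : 'I_d -> int_ring K)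
  (lam : 'I_d -> {additive int_ring K -> int}), is_Zbasis w lam.
Proof.
have /choice[e he] : forall i : 'I_n.+1, exists e : int_ring K,
    exists2 N : nat, (0 < N)%N & val e = N%:R * b`_i.
  move=> i; have [N N0 h] := integral_multiple b`_i.
  by exists (MkInt h), N.
have /choice[t ht] : forall xi : int_ring K * 'I_n.+1, exists z : int,
    Tr (val xi.1 * val (e xi.2)) = z%:~R.
  by move=> [x i]; apply: Tr_integral; rewrite rpredM //; exact: valP.
have tB i : zmod_morphism (fun x => t (x, i)).
  move=> x y; apply: (@intr_inj rat); rewrite rmorphB /= -!ht /=.
  by rewrite mulrBl raddfB.
pose phi i : {additive int_ring K -> int} := HB.pack (fun x => t (x, i))
  (GRing.isZmodMorphism.Build _ _ _ (tB i)).
apply: (Zbasis_exists (phi := phi)) => x phi0; apply: val_inj.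
rewrite rmorph0; apply: Tr_nondegenerate => y.
rewrite [y]coord_b mulr_sumr raddf_sum big1 // => i _ /=.
rewrite -scalerAr TrZ; have [N N0 eN] := he i.
have : N%:R * Tr (val x * b`_i) = 0.
  rewrite mulr_natl -raddfMn /= -mulr_natl mulrCA -eN.
  by have := ht (x, i) => /= ->; rewrite -[t _]/(phi i x) phi0.
move/eqP; rewrite mulf_eq0 pnatr_eq0 -leqn0 leqNgt N0 => /eqP->.
by rewrite mulr0.
Qed.

End Trace.

Lemma int_ring_Zbasis (K : fieldExtType rat) :
  exists (d : nat) (w : 'I_d.+1 -> int_ring K)
    (lam : 'I_d.+1 -> {additive int_ring K -> int}), is_Zbasis w lam.
Proof.
have [n [b bb]] : exists n (b : n.+1.-tuple K), basis_of fullv b.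
  have := vbasisP {:K}; have := adim_gt0 {:K}%AS.
  move: (vbasis _); case: (\dim _) => // n b _ hb; by exists n, b.
have [[|d] [w [lam bas]]] := int_ring_Zbasis_of bb; last by exists d, w, lam.
have := bas.1 1; rewrite big_ord0 => /eqP; by rewrite oner_eq0.
Qed.

(** * Integral points: O (x) Z_l *)

Section PadicIntegers.
Variable l : prime_number.
Local Notation p := (val l).
Implicit Types (x y : Zp l) (n k : nat).

Let p_gt0 : (0 < p)%N. Proof. exact: prime_gt0 (valP l). Qed.

(** Index [n] stands for the modulus [p ^ n.+1], as in the inverse system that defines [Zp];
    [sp_red] keeps this shift. *)
Definition Zp_red n x : Zpow l n := Zp_val x n.

Let Zp_redB n : zmod_morphism (Zp_red n). Proof. by []. Qed.
HB.instance Definition _ n :=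
  GRing.isZmodMorphism.Build (Zp l) (Zpow l n) (Zp_red n) (Zp_redB n).
Let Zp_red_monoid n : monoid_morphism (Zp_red n). Proof. by []. Qed.
HB.instance Definition _ n :=
  GRing.isMonoidMorphism.Build (Zp l) (Zpow l n) (Zp_red n) (Zp_red_monoid n).

Lemma Zp_eq x y : (forall n, Zp_red n x = Zp_red n y) -> x = y.
Proof. by move=> h; apply: val_inj; apply: functional_extensionality_dep. Qed.

Lemma val_Zpow_nat n (k : nat) : ((k%:R%R : Zpow l n) : nat) = (k %% p ^ n.+1)%N.
Proof. by rewrite val_Zp_nat ?Zpow_gt1. Qed.

Lemma Zpow_natP n (j k : nat) :
  j%:R = k%:R :> Zpow l n <-> j = k %[mod p ^ n.+1].
Proof.
split=> [/(congr1 (fun z : Zpow l n => (z : nat)))|h].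
  by rewrite !val_Zpow_nat.
by apply: val_inj; rewrite /= !val_Zpow_nat.
Qed.

Lemma Zp_red_coh x n : (Zp_red n.+1 x : nat)%:R = Zp_red n x :> Zpow l n.
Proof. by case: x => x /= /asboolP h; exact: h. Qed.

Lemma Zp_red_lt x n : (Zp_red n x < p ^ n.+1)%N.
Proof.
by rewrite -{2}(Zp_cast (Zpow_gt1 l n)) ltn_ord.
Qed.

Lemma Zp_red_mod x n k : ((Zp_red (n + k) x : nat) %% p ^ n.+1)%N = Zp_red n x.
Proof.
elim: k => [|k IH]; first by rewrite addn0 modn_small // Zp_red_lt.
rewrite -IH addnS -(Zp_red_coh x (n + k)) val_Zpow_nat modn_dvdm //.
by rewrite dvdn_exp2l // ltnS leq_addr.
Qed.

Lemma Zp_mk (u : nat -> nat) :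
  (forall n, u n.+1 = u n %[mod p ^ n.+1]) ->
  exists x, forall n, Zp_red n x = (u n)%:R.
Proof.
move=> uE; have coh : (fun n => (u n)%:R : Zpow l n) \in @coherent l.
  apply/asboolP => n; rewrite val_Zpow_nat; apply/Zpow_natP.
  by rewrite modn_dvdm ?uE // dvdn_exp2l.
by exists (MkZp coh).
Qed.

(** The residue of [y] at level [k] is that of [x] at level [n.+1 + k], divided by [p ^ n.+1]. *)
Lemma Zp_dvdP x n : Zp_red n x = 0 -> exists y, x = p%:R ^+ n.+1 * y.
Proof.
move=> x0; pose r k : nat := Zp_red k x; pose X k := r (n.+1 + k)%N.
have r_mod m k : (r (m + k) %% p ^ m.+1)%N = r m by exact: Zp_red_mod.
have r_lt m : (r m < p ^ m.+1)%N by exact: Zp_red_lt.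
have dX k : (p ^ n.+1 %| X k)%N.
  by rewrite /dvdn /X addSnnS r_mod /r x0.
have XE k : (p ^ n.+1 * (X k %/ p ^ n.+1))%N = X k by rewrite mulnC divnK.
have [|y yE] := @Zp_mk (fun k => (X k %/ p ^ n.+1)%N).
  move=> k; apply/eqP; rewrite -(eqn_pmul2l (_ : 0 < p ^ n.+1)%N) ?expn_gt0 ?p_gt0 //.
  rewrite !muln_modr !XE -expnD addnS; apply/eqP.
  have -> : (X k.+1 %% p ^ (n.+1 + k).+1)%N = X k.
    by have := r_mod (n.+1 + k)%N 1%N; rewrite addn1 /X addnS.
  by rewrite modn_small // r_lt.
exists y; apply: Zp_eq => k.
rewrite rmorphM rmorphXn rmorph_nat /= yE -natrX -natrM XE.
rewrite -[LHS]natr_Zp; apply/Zpow_natP.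
by rewrite /X addnC r_mod modn_small // r_lt.
Qed.

Lemma Zp_red_dvd n k y : (n < k)%N -> Zp_red n (p%:R ^+ k * y) = 0.
Proof.
move=> nk; rewrite rmorphM rmorphXn rmorph_nat -natrX.
have -> : (p ^ k)%:R = 0%:R :> Zpow l n; last by rewrite mul0r.
by apply/Zpow_natP; rewrite mod0n; apply/eqP; exact: dvdn_exp2l.
Qed.

Lemma Zp_unitP x : Zp_red 0 x != 0 -> x \is a GRing.unit.
Proof.
move=> x0; have x_unit n : Zp_red n x \is a GRing.unit.
  rewrite -[Zp_red n x]natr_Zp unitZpE ?Zpow_gt1 //.
  rewrite coprime_pexpl // prime_coprime ?(valP l) //.
  apply: contra x0 => px; apply/eqP/val_inj => /=.
  by rewrite -(Zp_red_mod x 0 n) add0n expn1; apply/eqP.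
have [n|y yE] := @Zp_mk (fun n => (Zp_red n x)^-1 : nat).
  apply/Zpow_natP; rewrite natr_Zp.
  apply: (mulrI (x_unit n)); rewrite divrr ?x_unit // -{1}(Zp_red_coh x n).
  rewrite -natrM; apply/(Zpow_natP n _ 1%N).
  have : ((Zp_red n.+1 x : nat) * ((Zp_red n.+1 x)^-1 : Zpow l n.+1)%R)%N%:R
      = 1%:R :> Zpow l n.+1.
    by rewrite natrM !natr_Zp divrr ?x_unit.
  move/Zpow_natP/(congr1 (fun m => m %% p ^ n.+1)%N).
  by rewrite !modn_dvdm // dvdn_exp2l.
have xy : x * y = 1.
  by apply: Zp_eq => n; rewrite rmorphM rmorph1 /= yE natr_Zp divrr ?x_unit.
by apply/unitrP; exists y; split=> //; rewrite mulrC.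
Qed.

End PadicIntegers.

(** * Coordinates on [O (x) B] for a free [O] *)

Section TensorCoordinates.
Variables (O : comPzRingType) (d : nat) (w : 'I_d.+1 -> O).
Variable lam : 'I_d.+1 -> {additive O -> int}.
Hypothesis basis_w : is_Zbasis w lam.

Section OneRing.
Variable B : comPzRingType.
Implicit Types (t u : tens O B) (c : B).

Definition tcoord_fun i (a : O) c : B := c *~ lam i a.

Lemma tcoord_biadd i : biadditive (tcoord_fun i).
Proof. by split=> *; rewrite /tcoord_fun ?raddfD ?mulrzDr ?mulrzDl. Qed.

Definition tcoord i : tens O B -> B := tens_lift (tcoord_fun i).

HB.instance Definition _ i := GRing.isZmodMorphism.Build (tens O B) B
  (tcoord i) (tens_liftB (tcoord_biadd i)).

Lemma tcoord_pure i a c : tcoord i (pure a c) = c *~ lam i a.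
Proof.
by rewrite /tcoord tens_liftE ?/tens_eval ?big_seq1 //; exact: tcoord_biadd.
Qed.

Lemma tens_ind (P : tens O B -> Prop) : P 0 ->
  (forall a c t, P t -> P (pure a c + t)) -> forall t, P t.
Proof.
move=> P0 PS t; rewrite -[t]reprK; elim: (generic_quotient.repr t) => [|[a c] s IH].
  exact: P0.
by rewrite -cat1s -tens_piD; exact: PS.
Qed.

Let pureDl a a' c : pure (a + a') c = pure a c + pure a' c :> tens O B.
Proof. exact: (biadditive_pure O B).1. Qed.
Let pureDr a c c' : pure a (c + c') = pure a c + pure a c' :> tens O B.
Proof. exact: (biadditive_pure O B).2. Qed.

Lemma pureMz a (z : int) c : pure (a *~ z) c = pure a (c *~ z) :> tens O B.
Proof.
have nat_case (k : nat) : pure (a *+ k) c = pure a (c *+ k) :> tens O B.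
  elim: k => [|k IH]; last by rewrite !mulrS pureDl pureDr IH.
  rewrite !mulr0n; have hb := biadditive_pure O B.
  by rewrite (biadd0l _ hb) (biadd0r _ hb).
case: z => k; first exact: nat_case.
rewrite !NegzE !mulrNz (biaddNl _ _ (biadditive_pure O B)).
apply: (addrI (pure a (c *+ k.+1))); rewrite -pureDr -[in LHS]nat_case subrr subrr.
by rewrite (biadd0r _ (biadditive_pure O B)).
Qed.

Lemma tens_sum_pure (I : finType) (f : I -> O) c :
  pure (\sum_i f i) c = \sum_i pure (f i) c :> tens O B.
Proof.
elim/big_rec2: _ => [|i u v _ <-]; last exact: pureDl.
exact: (biadd0l _ (biadditive_pure O B)).
Qed.

Lemma tcoordE t : t = \sum_i pure (w i) (tcoord i t).
Proof.
elim/tens_ind: t => [|a c t IH].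
  rewrite big1 // => i _; rewrite raddf0.
  exact: (biadd0r _ (biadditive_pure O B)).
rewrite {1}IH [in LHS](basis_w.1 a) tens_sum_pure -big_split /=.
by apply: eq_bigr => i _; rewrite raddfD /= tcoord_pure pureDr pureMz.
Qed.

Lemma tcoord_inj t u : (forall i, tcoord i t = tcoord i u) -> t = u.
Proof.
by move=> h; rewrite [t]tcoordE [u]tcoordE; apply: eq_bigr => i _; rewrite h.
Qed.

Lemma tcoord_sum (c : 'I_d.+1 -> B) i : tcoord i (\sum_j pure (w j) (c j)) = c i.
Proof.
rewrite raddf_sum (bigD1 i) //= tcoord_pure basis_w.2 eqxx mulr1z big1 ?addr0 //.
by move=> j ji; rewrite tcoord_pure basis_w.2 eq_sym (negPf ji) mulr0z.
Qed.

Lemma tcoordMr i t c : tcoord i (t * pure 1 c) = tcoord i t * c.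
Proof.
elim/tens_ind: t => [|a c' t IH]; first by rewrite mul0r !raddf0 mul0r.
rewrite mulrDl !raddfD /= IH -pure_mul !tcoord_pure mulr1.
by rewrite mulrDl mulrzAl.
Qed.

(** The regular representation of [O (x) B] over [B]. It reduces units to determinants and turns
    symplectic matrices over [O (x) Z_l] into matrices over [Z_l]. *)
Definition tens_mx t : 'M[B]_d.+1 := \matrix_(i, j) tcoord i (t * pure (w j) 1).

Lemma tens_mx_mul t (c : 'cV[B]_d.+1) i :
  (tens_mx t *m c) i 0 = tcoord i (t * \sum_j pure (w j) (c j 0)).
Proof.
rewrite mxE mulr_sumr raddf_sum; apply: eq_bigr => j _.
by rewrite mxE -tcoordMr -mulrA -pure_mul mulr1 mul1r.
Qed.

Let tens_mxB : zmod_morphism tens_mx.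
Proof. by move=> t u; apply/matrixP => i j; rewrite !mxE mulrBl raddfB. Qed.
HB.instance Definition _ := GRing.isZmodMorphism.Build (tens O B) 'M[B]_d.+1
  tens_mx tens_mxB.

Lemma tens_mx1 : tens_mx 1 = 1%:M.
Proof.
apply/matrixP => i j; rewrite !mxE mul1r tcoord_pure basis_w.2.
by case: eqP => // _; rewrite mulr0z.
Qed.

Lemma tens_mxM t u : tens_mx (t * u) = tens_mx t *m tens_mx u.
Proof.
apply/matrixP => i j; rewrite !mxE.
rewrite -mulrA [in LHS](tcoordE (u * _)) mulr_sumr raddf_sum /=.
apply: eq_bigr => k _; rewrite !mxE -tcoordMr -mulrA -pure_mul.
by rewrite mulr1 mul1r.
Qed.

End OneRing.

Lemma tcoord_map (B C : comPzRingType) (f : {rmorphism B -> C}) i t :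
  tcoord i (tens_map f t) = f (tcoord i t) :> C.
Proof.
elim/tens_ind: t => [|a c t IH]; first by rewrite !raddf0.
rewrite !raddfD /= IH tcoord_pure raddfMz; congr (_ + _).
rewrite [tens_map f _]tens_liftE; last exact: tens_map_biadd.
by rewrite /tens_eval big_seq1 tcoord_pure.
Qed.

Lemma tens_map_inj (B C : comPzRingType) (f : {rmorphism B -> C}) :
  injective f -> injective (tens_map f : tens O B -> tens O C).
Proof.
move=> f_inj t u e; apply: tcoord_inj => i; apply: f_inj.
by rewrite -!tcoord_map e.
Qed.

End TensorCoordinates.

(** * Units and stable range in [O (x) Z_l] *)

Section TensorPadic.
Variables (O : comPzRingType) (d : nat) (w : 'I_d.+1 -> O).
Variable lam : 'I_d.+1 -> {additive O -> int}.
Hypothesis basis_w : is_Zbasis w lam.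
Variable l : prime_number.
Local Notation p := (val l).
Local Notation A := (tens O (Zp l)).
Implicit Types (a b c e s t u x y z : A) (n k : nat).

Lemma tcoord_natM (B : comPzRingType) i (m : nat) (t : tens O B) :
  tcoord lam i (m%:R * t) = m%:R * tcoord lam i t.
Proof. by rewrite !mulr_natl raddfMn. Qed.

Lemma tcoord_natXM (B : comPzRingType) i (m n : nat) (t : tens O B) :
  tcoord lam i (m%:R ^+ n * t) = m%:R ^+ n * tcoord lam i t.
Proof. by rewrite -!natrX tcoord_natM. Qed.

Lemma tens_dvdP n t : (forall i, Zp_red n (tcoord lam i t) = 0) <->
  exists u, t = p%:R ^+ n.+1 * u.
Proof.
split=> [h|[u ->] i]; last by rewrite tcoord_natXM Zp_red_dvd.
have /choice[y yE] i := Zp_dvdP (h i).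
exists (\sum_i pure (w i) (y i)); apply: (tcoord_inj basis_w) => i.
by rewrite tcoord_natXM (tcoord_sum basis_w) yE.
Qed.

Lemma tens_separated t :
  (forall n, exists u, t = p%:R ^+ n.+1 * u) -> t = 0.
Proof.
move=> h; apply: (tcoord_inj basis_w) => i; rewrite raddf0.
by apply: Zp_eq => n; rewrite raddf0; exact: (tens_dvdP n t).2 (h n) i.
Qed.

(** The matrix of multiplication by [1 + p * t] is the identity modulo [p], so its determinant is a
    unit of [Z_l]; the inverse is the solution of a linear system. *)
Lemma tens_unit1 t : exists s, (1 + p%:R * t) * s = 1.
Proof.
set u := 1 + _; pose M := tens_mx w lam u.
have Mu : M \in unitmx.
  apply: Zp_unitP; rewrite -det_map_mx.
  suff -> : map_mx (@Zp_red l 0) M = 1%:M by rewrite det1 oner_eq0.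
  rewrite /M raddfD raddfD /= -[p%:R]expr1.
  rewrite (tens_mx1 basis_w) map_mx1 -[RHS]addr0; congr (_ + _); apply/matrixP => i j.
  by rewrite !mxE -mulrA tcoord_natXM Zp_red_dvd.
pose v := invmx M *m \col_i tcoord lam i 1.
exists (\sum_j pure (w j) (v j 0)); apply: (tcoord_inj basis_w) => i.
by rewrite -tens_mx_mul -/M mulKVmx // mxE.
Qed.

Lemma tens_unit_nat m : coprime m p -> exists s, m%:R * s = 1 :> A.
Proof.
move=> cmp; have m0 : (0 < m)%N.
  case: m cmp => //; rewrite /coprime gcd0n => /eqP p1.
  by have := prime_gt1 (valP l); rewrite p1.
case: (egcdnP p m0) => j k jk _.
have [s sE] := tens_unit1 k%:R; exists (j%:R * s).
rewrite mulrA -natrM mulnC jk (eqP cmp) -[RHS]sE natrD natrM; congr (_ * _).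
by rewrite addrC mulrC.
Qed.

Lemma tens_power_repeats a :
  exists i k, (0 < k)%N /\ exists u, a ^+ (i + k) = a ^+ i + p%:R * u.
Proof.
pose res t : {ffun 'I_d.+1 -> Zpow l 0} :=
  [ffun i => Zp_red 0 (tcoord lam i t)].
pose T : finType := {ffun 'I_d.+1 -> 'Z_(p ^ 1)}.
pose f (i : 'I_#|T|.+1) : T := res (a ^+ i).
have /injectivePn[i [j ij fij]] : ~~ injectiveb f.
  by apply/negP => /injectiveP/leq_card; rewrite card_ord ltnn.
wlog lt_ij : i j ij fij / (i < j)%N.
  move=> wl; have := ij; rewrite -val_eqE /= neq_ltn => /orP[] h.
    exact: (wl i j).
  by apply: (wl j i) => //; rewrite eq_sym.
exists i, (j - i)%N; rewrite subn_gt0 subnKC ?(ltnW lt_ij) //; split=> //.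
have [|u uE] := (tens_dvdP 0 (a ^+ j - a ^+ i)).1.
  move=> k; have /ffunP/(_ k) := fij; rewrite !ffunE => e.
  by rewrite !raddfB /= e subrr.
by exists u; rewrite -[p%:R]expr1 -uE addrC subrK.
Qed.

Lemma tens_idempotent_power a :
  exists2 k, (0 < k)%N & exists u, a ^+ k * a ^+ k = a ^+ k + p%:R * u.
Proof.
have [i [k [k0 [u uE]]]] := tens_power_repeats a.
have step m : exists v, a ^+ (i + m * k) = a ^+ i + p%:R * v.
  elim: m => [|m [v vE]]; first by exists 0; rewrite mul0n addn0 mulr0 addr0.
  exists (u + v * a ^+ k); rewrite mulSn addnCA addnC exprD vE.
  by rewrite mulrDl -exprD uE; ring.
(* A multiple of the period [k] that is at least the preperiod [i]: this power is idempotent modulo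
   [p]. *)
exists (i.+1 * k)%N; first by rewrite muln_gt0.
have [v vE] := step i.+1.
have le : (i <= i.+1 * k)%N by rewrite (leq_trans (leqnSn i)) // leq_pmulr.
exists (v * a ^+ (i.+1 * k - i)).
have E m : a ^+ (i.+1 * k) * m = a ^+ (i.+1 * k - i) * (a ^+ i * m).
  by rewrite mulrA -exprD subnK.
rewrite E -exprD vE mulrDr -exprD subnK //; ring.
Qed.

(* Let [e] be an idempotent power of [a] modulo [p].  Then [a + (1 - e) b] is *)
(* congruent to the unit [a] on the part where [e = 1], and to [b] plus a     *)
(* nilpotent on the part where [e = 0], where [b] is a unit.                  *)
Lemma tens_stable_range a b x y : a * x + b * y = 1 ->
  exists t z, (a + t * b) * z = 1.
Proof.
move=> axby; have [k k0 [u uE]] := tens_idempotent_power a.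
set e := a ^+ k in uE; set c := a + (1 - e) * b.
(* [I] is the ideal generated by [c] and [p]. As [1 + p * t] is always a unit, so is [c] once [I]
   contains 1. *)
pose I z := exists s t, z = c * s + p%:R * t.
have ID s t : I s -> I t -> I (s + t).
  by move=> [s1 [s2 ->]] [t1 [t2 ->]]; exists (s1 + t1), (s2 + t2); ring.
have IM s t : I s -> I (s * t).
  by move=> [s1 [s2 ->]]; exists (s1 * t), (s2 * t); ring.
have Ip t : I (p%:R * t) by exists 0, t; ring.
have Ic : I c by exists 1, 0; ring.
have Ie : I e.
  have -> : e = c * (e * a ^+ k.-1) + p%:R * (- u + u * b * a ^+ k.-1).
    have ea : a * a ^+ k.-1 = e by rewrite -exprS prednK.
    have -> : c * (e * a ^+ k.-1)
      = e * (a * a ^+ k.-1) + (e - e * e) * b * a ^+ k.-1 by rewrite /c; ring.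
    by rewrite ea uE; ring.
  exact: ID (IM _ _ Ic) (Ip _).
have Iab : I (a + b).
  have -> : a + b = c + e * b by rewrite /c; ring.
  exact: ID Ic (IM _ _ Ie).
(* Modulo [a + b], which lies in [I], [a * (x - y)] equals [a * x + b * y = 1]. As [a ^+ k = e] also
   lies in [I], so does 1. *)
have I1 m : I (1 - a ^+ m * (x - y) ^+ m).
  elim: m => [|m IH]; first by rewrite !expr0 mulr1 subrr; exists 0, 0; ring.
  have -> : 1 - a ^+ m.+1 * (x - y) ^+ m.+1
    = (1 - a ^+ m * (x - y) ^+ m) * (a * (x - y)) + (a + b) * y.
    by transitivity (a * x + b * y - a ^+ m.+1 * (x - y) ^+ m.+1);
      [rewrite axby | rewrite !exprS; move: (a ^+ m) (_ ^+ m) => P Q; ring].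
  exact: ID (IM _ _ IH) (IM _ _ Iab).
have [s [t stE]] : I 1.
  have -> : 1 = (1 - a ^+ k * (x - y) ^+ k) + e * (x - y) ^+ k :> A.
    by rewrite subrK.
  exact: ID (I1 k) (IM _ _ Ie).
have [v vE] := tens_unit1 (- t).
exists (1 - e), (s * v); rewrite -/c mulrA.
have -> : c * s = 1 + p%:R * - t.
  by apply: (addIr (p%:R * t)); rewrite -stE mulrN subrK.
exact: vE.
Qed.

End TensorPadic.

(** * Root elements and elimination in Sp_4 *)

Section Matrix4.
Variable A : comPzRingType.
Implicit Types a b c s t u x y : A.

(** With explicit entries, identities between products of matrices become sixteen goals for
    [ring]. *)
Definition mx4 a00 a01 a02 a03 a10 a11 a12 a13
    a20 a21 a22 a23 a30 a31 a32 a33 : 'M[A]_4 :=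
  \matrix_(i, j) nth 0 (nth [::]
    [:: [:: a00; a01; a02; a03]; [:: a10; a11; a12; a13];
        [:: a20; a21; a22; a23]; [:: a30; a31; a32; a33]] i) j.

Definition ord40 : 'I_4 := @Ordinal 4 0 isT.
Definition ord41 : 'I_4 := @Ordinal 4 1 isT.
Definition ord42 : 'I_4 := @Ordinal 4 2 isT.
Definition ord43 : 'I_4 := @Ordinal 4 3 isT.

Lemma ord4P (P : 'I_4 -> Prop) :
  P ord40 -> P ord41 -> P ord42 -> P ord43 -> forall i, P i.
Proof.
move=> p0 p1 p2 p3 [[|[|[|[|i]]]] hi] //.
- by rewrite (_ : Ordinal hi = ord40) //; apply: val_inj.
- by rewrite (_ : Ordinal hi = ord41) //; apply: val_inj.
- by rewrite (_ : Ordinal hi = ord42) //; apply: val_inj.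
- by rewrite (_ : Ordinal hi = ord43) //; apply: val_inj.
Qed.

Lemma sum_ord4 (f : 'I_4 -> A) :
  \sum_i f i = f ord40 + f ord41 + f ord42 + f ord43.
Proof.
rewrite !big_ord_recr big_ord0 /= add0r.
by congr (_ + _ + _ + _); congr f; apply: val_inj.
Qed.

Lemma mx4_eta (g : 'M[A]_4) : g = mx4
  (g ord40 ord40) (g ord40 ord41) (g ord40 ord42) (g ord40 ord43)
  (g ord41 ord40) (g ord41 ord41) (g ord41 ord42) (g ord41 ord43)
  (g ord42 ord40) (g ord42 ord41) (g ord42 ord42) (g ord42 ord43)
  (g ord43 ord40) (g ord43 ord41) (g ord43 ord42) (g ord43 ord43).
Proof.
apply/matrixP => i j; move: i j.
by apply: ord4P; apply: ord4P; rewrite !mxE.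
Qed.

Lemma mx4_mul a00 a01 a02 a03 a10 a11 a12 a13
    a20 a21 a22 a23 a30 a31 a32 a33
    b00 b01 b02 b03 b10 b11 b12 b13
    b20 b21 b22 b23 b30 b31 b32 b33 :
  mx4 a00 a01 a02 a03 a10 a11 a12 a13 a20 a21 a22 a23 a30 a31 a32 a33 *m
  mx4 b00 b01 b02 b03 b10 b11 b12 b13 b20 b21 b22 b23 b30 b31 b32 b33 =
  mx4
    (a00 * b00 + a01 * b10 + a02 * b20 + a03 * b30)
    (a00 * b01 + a01 * b11 + a02 * b21 + a03 * b31)
    (a00 * b02 + a01 * b12 + a02 * b22 + a03 * b32)
    (a00 * b03 + a01 * b13 + a02 * b23 + a03 * b33)
    (a10 * b00 + a11 * b10 + a12 * b20 + a13 * b30)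
    (a10 * b01 + a11 * b11 + a12 * b21 + a13 * b31)
    (a10 * b02 + a11 * b12 + a12 * b22 + a13 * b32)
    (a10 * b03 + a11 * b13 + a12 * b23 + a13 * b33)
    (a20 * b00 + a21 * b10 + a22 * b20 + a23 * b30)
    (a20 * b01 + a21 * b11 + a22 * b21 + a23 * b31)
    (a20 * b02 + a21 * b12 + a22 * b22 + a23 * b32)
    (a20 * b03 + a21 * b13 + a22 * b23 + a23 * b33)
    (a30 * b00 + a31 * b10 + a32 * b20 + a33 * b30)
    (a30 * b01 + a31 * b11 + a32 * b21 + a33 * b31)
    (a30 * b02 + a31 * b12 + a32 * b22 + a33 * b32)
    (a30 * b03 + a31 * b13 + a32 * b23 + a33 * b33).
Proof.
apply/matrixP => i j; move: i j.
by apply: ord4P; apply: ord4P; rewrite !mxE sum_ord4 !mxE.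
Qed.

Lemma mx4_tr a00 a01 a02 a03 a10 a11 a12 a13
    a20 a21 a22 a23 a30 a31 a32 a33 :
  (mx4 a00 a01 a02 a03 a10 a11 a12 a13 a20 a21 a22 a23 a30 a31 a32 a33)^T =
  mx4 a00 a10 a20 a30 a01 a11 a21 a31 a02 a12 a22 a32 a03 a13 a23 a33.
Proof.
apply/matrixP => i j; move: i j.
by apply: ord4P; apply: ord4P; rewrite !mxE.
Qed.

Lemma mx4_sympJ : sympJ A = mx4 0 0 0 1  0 0 1 0  0 (-1) 0 0  (-1) 0 0 0.
Proof.
apply/matrixP => i j; move: i j.
by apply: ord4P; apply: ord4P; rewrite !mxE.
Qed.

Lemma mx4_1 : 1%:M = mx4 1 0 0 0  0 1 0 0  0 0 1 0  0 0 0 1.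
Proof.
apply/matrixP => i j; move: i j.
by apply: ord4P; apply: ord4P; rewrite !mxE.
Qed.

(* The parameter of the root subgroup [Rij] is its [(i, j)] entry; [R03],      *)
(* [R30], [R12] and [R21] are the long roots.                                 *)
Inductive root := R03 | R30 | R12 | R21 | R01 | R10 | R02 | R20.

Definition root_mx (r : root) s : 'M[A]_4 :=
  match r with
  | R03 => mx4 1 0 0 s  0 1 0 0  0 0 1 0  0 0 0 1
  | R30 => mx4 1 0 0 0  0 1 0 0  0 0 1 0  s 0 0 1
  | R12 => mx4 1 0 0 0  0 1 s 0  0 0 1 0  0 0 0 1
  | R21 => mx4 1 0 0 0  0 1 0 0  0 s 1 0  0 0 0 1
  | R01 => mx4 1 s 0 0  0 1 0 0  0 0 1 (- s)  0 0 0 1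
  | R10 => mx4 1 0 0 0  s 1 0 0  0 0 1 0  0 0 (- s) 1
  | R02 => mx4 1 0 s 0  0 1 0 s  0 0 1 0  0 0 0 1
  | R20 => mx4 1 0 0 0  0 1 0 0  s 0 1 0  0 s 0 1
  end.

Ltac mx4_ring := rewrite ?mx4_1 ?mx4_sympJ ?mx4_tr ?mx4_mul; congr mx4; ring.

Lemma root_mxD r s t : root_mx r s *m root_mx r t = root_mx r (s + t).
Proof. by case: r => /=; mx4_ring. Qed.

Lemma root_mx0 r : root_mx r 0 = 1%:M.
Proof. by case: r => /=; rewrite mx4_1 ?oppr0. Qed.

Lemma root_mx_symplectic r s : root_mx r s \in @symplectic A.
Proof.
apply/asboolP; split.
  by exists (root_mx r (- s)); rewrite !root_mxD subrr addNr root_mx0.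
by case: r => /=; mx4_ring.
Qed.

Definition root_elt r s : Sp4 A := MkSp4 (root_mx_symplectic r s).

Local Open Scope group_scope.

Lemma root_eltD r s t : root_elt r (s + t)%R = root_elt r s * root_elt r t.
Proof. by apply: val_inj; rewrite /= root_mxD. Qed.

Lemma root_elt0 r : root_elt r 0%R = 1.
Proof. by apply: val_inj; rewrite /= root_mx0. Qed.

Lemma root_eltN r s : root_elt r (- s)%R = (root_elt r s)^-1.
Proof.
by apply: (mulgI (root_elt r s)); rewrite -root_eltD subrr root_elt0 mulgV.
Qed.

Lemma root_eltX r s n : root_elt r (s *+ n)%R = root_elt r s ^+ n.
Proof.
elim: n => [|n IH]; first by rewrite mulr0n root_elt0 expg0.
by rewrite mulrS root_eltD IH expgS.
Qed.

(** In this and the next three commutators two short roots add up to a long root; the structure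
    constant is 2, up to sign. *)
Lemma comm_R03 s t :
  root_elt R01 s * root_elt R02 t * (root_elt R01 s)^-1 * (root_elt R02 t)^-1
  = root_elt R03 (2%:R * s * t)%R.
Proof. by apply: val_inj; rewrite -!root_eltN /=; mx4_ring. Qed.

Lemma comm_R12 s t :
  root_elt R10 s * root_elt R02 t * (root_elt R10 s)^-1 * (root_elt R02 t)^-1
  = root_elt R12 (2%:R * s * t)%R.
Proof. by apply: val_inj; rewrite -!root_eltN /=; mx4_ring. Qed.

Lemma comm_R30 s t :
  root_elt R20 s * root_elt R10 t * (root_elt R20 s)^-1 * (root_elt R10 t)^-1
  = root_elt R30 (2%:R * s * t)%R.
Proof. by apply: val_inj; rewrite -!root_eltN /=; mx4_ring. Qed.

Lemma comm_R21 s t :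
  root_elt R20 s * root_elt R01 t * (root_elt R20 s)^-1 * (root_elt R01 t)^-1
  = root_elt R21 (2%:R * s * t)%R.
Proof. by apply: val_inj; rewrite -!root_eltN /=; mx4_ring. Qed.

(** From here on a long root meets a short one, and the commutator has a short and a long component;
    [roots_of_comm] divides out the long one. *)
Lemma comm_R02 s t :
  root_elt R03 s * root_elt R10 t * (root_elt R03 s)^-1 * (root_elt R10 t)^-1
  = root_elt R02 (- (s * t))%R * root_elt R12 (- (s * t * t))%R.
Proof. by apply: val_inj; rewrite -!root_eltN /=; mx4_ring. Qed.

Lemma comm_R01 s t :
  root_elt R03 s * root_elt R20 t * (root_elt R03 s)^-1 * (root_elt R20 t)^-1
  = root_elt R01 (s * t)%R * root_elt R21 (s * t * t)%R.
Proof. by apply: val_inj; rewrite -!root_eltN /=; mx4_ring. Qed.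

Lemma comm_R20 s t :
  root_elt R30 s * root_elt R01 t * (root_elt R30 s)^-1 * (root_elt R01 t)^-1
  = root_elt R20 (s * t)%R * root_elt R21 (- (s * t * t))%R.
Proof. by apply: val_inj; rewrite -!root_eltN /=; mx4_ring. Qed.

Lemma comm_R10 s t :
  root_elt R30 s * root_elt R02 t * (root_elt R30 s)^-1 * (root_elt R02 t)^-1
  = root_elt R10 (- (s * t))%R * root_elt R12 (s * t * t)%R.
Proof. by apply: val_inj; rewrite -!root_eltN /=; mx4_ring. Qed.

Definition short_pair (r1 r2 : root) : Prop :=
  (r1, r2) = (R01, R02) \/ (r1, r2) = (R10, R02) \/
  (r1, r2) = (R20, R10) \/ (r1, r2) = (R20, R01).

(** The commutator lies in a long root subgroup that commutes with both short ones. This is the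
    hypothesis of [pgroup_gen2]. *)
Lemma short_pair_commute r1 r2 s t : short_pair r1 r2 ->
  let x := root_elt r1 s in let y := root_elt r2 t in
  commute x [~ x, y] /\ commute y [~ x, y].
Proof.
(* [[~ x, y]] is [x^-1 * y^-1 * x * y], so the parameters change sign before the formulas above
   apply. *)
have E (r r' : root) : [~ root_elt r s, root_elt r' t] =
    root_elt r (- s)%R * root_elt r' (- t)%R
    * (root_elt r (- s)%R)^-1 * (root_elt r' (- t)%R)^-1.
  by rewrite -!root_eltN !opprK /commg /conjg -!root_eltN !mulgA.
move=> [|[|[|]]] [-> ->] x y; rewrite /x /y E.
- by rewrite comm_R03; split; apply: val_inj => /=; mx4_ring.
- by rewrite comm_R12; split; apply: val_inj => /=; mx4_ring.
- by rewrite comm_R30; split; apply: val_inj => /=; mx4_ring.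
- by rewrite comm_R21; split; apply: val_inj => /=; mx4_ring.
Qed.

Lemma symplectic_rel (g : Sp4 A) j k :
  (Sp4_val g ord40 j * Sp4_val g ord43 k + Sp4_val g ord41 j * Sp4_val g ord42 k
   - Sp4_val g ord42 j * Sp4_val g ord41 k
   - Sp4_val g ord43 j * Sp4_val g ord40 k = sympJ A j k)%R.
Proof.
case: g => g /= /asboolP[_ gJ]; rewrite -[in RHS]gJ mx4_sympJ.
by rewrite !mxE !(sum_ord4, mxE) /=; ring.
Qed.

(** The kernel of reduction modulo [c], expressed without the quotient ring. *)
Definition cong_mx (c : A) : set (Sp4 A) :=
  [set g | exists W : 'M_4, Sp4_val g = 1%:M + c *: W]%R.

Lemma cong_mx_root r c s : cong_mx c (root_elt r (c * s)%R).
Proof.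
exists (root_mx r s - 1%:M)%R; apply/matrixP; case: r; apply: ord4P;
  by apply: ord4P; rewrite !mxE /=; ring.
Qed.

Lemma cong_mx_subgroup c : is_subgroup (cong_mx c).
Proof.
split; first by exists 0%R; rewrite scaler0 addr0.
move=> g h [W gW] [W' hW'].
exists ((W - W') *m Sp4_val (h^-1)%g)%R.
rewrite scalemxAl scalerBr.
have -> : (c *: W - c *: W' = Sp4_val g - Sp4_val h)%R.
  by rewrite gW hW' opprD addrACA subrr add0r.
rewrite mulmxBl -[(Sp4_val h *m _)%R]/(Sp4_val (h * h^-1)%g) mulgV.
by rewrite addrC subrK.
Qed.

End Matrix4.

Section Subgroup.
Variables (G : groupType) (H : set G).
Hypothesis sgH : is_subgroup H.
Local Open Scope group_scope.

Lemma subgroup1 : H 1. Proof. by case: sgH. Qed.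

Lemma subgroupV g : H g -> H g^-1.
Proof. by move=> hg; have := sgH.2 _ _ subgroup1 hg; rewrite mul1g. Qed.

Lemma subgroupM g h : H g -> H h -> H (g * h).
Proof. by move=> hg /subgroupV hh; have := sgH.2 _ _ hg hh; rewrite invgK. Qed.

Lemma subgroupX g n : H g -> H (g ^+ n).
Proof.
move=> hg; elim: n => [|n IH]; first by rewrite expg0; exact: subgroup1.
by rewrite expgS; exact: subgroupM.
Qed.

Lemma subgroupMl g h : H g -> H (g * h) -> H h.
Proof. by move=> /subgroupV hg /(subgroupM hg); rewrite mulKg. Qed.

Lemma subgroupMr g h : H h -> H (g * h) -> H g.
Proof. by move=> /subgroupV hh /subgroupM/(_ hh); rewrite mulgK. Qed.

End Subgroup.

(** * Generation of congruence subgroups by root elements *)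

Section Generation.
Variables (A : comPzRingType) (H : set (Sp4 A)).
Hypothesis sgH : is_subgroup H.

Section Roots.
Variable c : A.
Local Open Scope group_scope.

Hypothesis normH : forall r s h, H h ->
  H (root_elt r (c * s)%R * h * (root_elt r (c * s)%R)^-1).

Hypothesis commH : forall r1 r2 s t, short_pair r1 r2 ->
  H (root_elt r1 (c * s)%R * root_elt r2 (c * t)%R
     * (root_elt r1 (c * s)%R)^-1 * (root_elt r2 (c * t)%R)^-1).

(* The commutators of short roots give the long roots; as H is normalised by  *)
(* the root elements, commutators with these give the short roots.            *)
Lemma roots_of_comm r s : H (root_elt r (2%:R * c ^+ 3 * s)%R).
Proof.
have E t : (2%:R * (c * t) * (c * 1))%R = (2%:R * c ^+ 2 * t)%R by ring.
have H03 t : H (root_elt R03 (2%:R * c ^+ 2 * t)%R).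
  by rewrite -E -comm_R03; apply: commH; left.
have H12 t : H (root_elt R12 (2%:R * c ^+ 2 * t)%R).
  by rewrite -E -comm_R12; apply: commH; right; left.
have H30 t : H (root_elt R30 (2%:R * c ^+ 2 * t)%R).
  by rewrite -E -comm_R30; apply: commH; do 2 right; left.
have H21 t : H (root_elt R21 (2%:R * c ^+ 2 * t)%R).
  by rewrite -E -comm_R21; apply: commH; do 3 right.
have cmH x r' t : H x ->
    H (x * root_elt r' (c * t)%R * x^-1 * (root_elt r' (c * t)%R)^-1).
  move=> Hx; rewrite -!mulgA; apply: (subgroupM sgH) => //; rewrite mulgA.
  by apply: normH; apply: (subgroupV sgH).
have E3 t : (2%:R * c ^+ 3 * t)%R = (2%:R * c ^+ 2 * (c * t))%R by ring.
have EX x : (2%:R * c ^+ 2 * x * (c * 1) * (c * 1))%R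
  = (2%:R * c ^+ 2 * (c ^+ 2 * x))%R by ring.
have EM x : (2%:R * c ^+ 2 * x * (c * 1))%R = (2%:R * c ^+ 2 * (c * x))%R.
  by ring.
have EN x : (- (2%:R * c ^+ 2 * x))%R = (2%:R * c ^+ 2 * - x)%R by ring.
case: r; rewrite ?E3 //.
- have := cmH _ R20 1%R (H03 s); rewrite comm_R01 EX EM.
  by move/(subgroupMr sgH (H21 _)).
- have := cmH _ R02 1%R (H30 (- s)%R); rewrite comm_R10 EX EM EN.
  by move/(subgroupMr sgH (H12 _)); rewrite -mulrN opprK.
- have := cmH _ R10 1%R (H03 (- s)%R); rewrite comm_R02 EX EM !EN.
  by move/(subgroupMr sgH (H12 _)); rewrite -mulrN opprK.
- have := cmH _ R01 1%R (H30 s); rewrite comm_R20 EX EM EN.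
  by move/(subgroupMr sgH (H21 _)).
Qed.

End Roots.
Section Elimination.
Variable c : A.
Local Open Scope group_scope.

Hypothesis rootH : forall r s, H (root_elt r (c * s)%R).
(** The multiplier of [b] is confined to [c ^+ 2 * A] because elimination must stay inside [C]. The
    condition is used in two situations: either [l] divides [c ^+ 2] and [a] is already a unit, or
    [c] is a unit and [tens_stable_range] applies. *)
Hypothesis stable_range : forall a b x y : A,
  (exists w, a = 1 + c ^+ 2 * w)%R -> (exists w, b = c ^+ 2 * w)%R ->
  (a * x + b * y = 1)%R -> exists t z, ((a + c ^+ 2 * t * b) * z = 1)%R.

Let C : set (Sp4 A) := cong_mx (c ^+ 2)%R.
Let sgC : is_subgroup C := cong_mx_subgroup _.

Let rootH2 r s : H (root_elt r (c ^+ 2 * s)%R).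
Proof. by rewrite expr2 -mulrA; exact: rootH. Qed.

Let rootC r s : C (root_elt r (c ^+ 2 * s)%R).
Proof. exact: cong_mx_root. Qed.

(** Root elements with parameter in [c ^+ 2 * A] lie in both [C] and [H], so [good] can be checked
    after multiplying by them on either side. *)
Let good g := C g -> H g.

Let goodl r s g : good (root_elt r (c ^+ 2 * s)%R * g) -> good g.
Proof.
move=> h Cg; apply: (subgroupMl sgH (rootH2 r s)); apply: h.
exact: (subgroupM sgC).
Qed.

Let goodr r s g : good (g * root_elt r (c ^+ 2 * s)%R) -> good g.
Proof.
move=> h Cg; apply: (subgroupMr sgH (rootH2 r s)); apply: h.
exact: (subgroupM sgC).
Qed.

(* For [u = 1 + c * (c * w)], [diag (u, 1 / u)] is a product of four          *)
(* elementary matrices with parameters in [c A]: this is why the conclusion   *)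
(* is about matrices congruent to [1] modulo [c ^+ 2].                        *)
Let torus03 u v w : (u * v = 1)%R -> (u = 1 + c ^+ 2 * w)%R ->
  exists2 h : Sp4 A, H h &
    Sp4_val h = mx4 u 0 0 0  0 1 0 0  0 0 1 0  0 0 0 v.
Proof.
move=> uv uE.
have e : (c ^+ 2 * w * v = 1 - v)%R by rewrite -uv uE; ring.
exists (root_elt R30 (c * - (w * v))%R * root_elt R03 (c * 1)%R
    * root_elt R30 (c * w)%R * root_elt R03 (c * - v)%R).
  by do !apply: (subgroupM sgH).
by rewrite /= uE !mx4_mul; congr mx4; ring: e.
Qed.

Let torus12 u v w : (u * v = 1)%R -> (u = 1 + c ^+ 2 * w)%R ->
  exists2 h : Sp4 A, H h &
    Sp4_val h = mx4 1 0 0 0  0 u 0 0  0 0 v 0  0 0 0 1.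
Proof.
move=> uv uE.
have e : (c ^+ 2 * w * v = 1 - v)%R by rewrite -uv uE; ring.
exists (root_elt R21 (c * - (w * v))%R * root_elt R12 (c * 1)%R
    * root_elt R21 (c * w)%R * root_elt R12 (c * - v)%R).
  by do !apply: (subgroupM sgH).
by rewrite /= uE !mx4_mul; congr mx4; ring: e.
Qed.

Let congE g : C g -> exists W : 'I_4 -> 'I_4 -> A,
  forall i j, (Sp4_val g i j = (i == j)%:R + c ^+ 2 * W i j)%R.
Proof. by move=> [W gW]; exists W => i j; rewrite gW !mxE. Qed.

Let good_diag (g : Sp4 A) u p s v : (u * v = 1)%R -> (p * s = 1)%R ->
  Sp4_val g = mx4 u 0 0 0  0 p 0 0  0 0 s 0  0 0 0 v -> good g.
Proof.
move=> uv ps gE /congE[W Wg].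
have := Wg ord40 ord40; rewrite gE mxE /= => uE.
have := Wg ord41 ord41; rewrite gE mxE /= => pE.
have [h1 Hh1 h1E] := torus03 uv uE.
have [h2 Hh2 h2E] := torus12 ps pE.
suff -> : g = h1 * h2 by exact: (subgroupM sgH).
apply: val_inj; rewrite [LHS]gE [RHS](_ : _ = Sp4_val h1 *m Sp4_val h2)%R //.
by rewrite h1E h2E mx4_mul; congr mx4; ring.
Qed.

Let good_unit_block (g : Sp4 A) u p q r s v z :
  (u * v = 1)%R -> (p * s - r * q = 1)%R -> (p * z = 1)%R ->
  Sp4_val g = mx4 u 0 0 0  0 p q 0  0 r s 0  0 0 0 v -> good g.
Proof.
move=> uv psrq pz gE Cg; have [W Wg] := congE Cg.
have := Wg ord41 ord42; rewrite gE mxE /= add0r => qE.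
have := Wg ord42 ord41; rewrite gE mxE /= add0r => rE.
move: Cg; apply: (@goodl R21 (- (W ord42 ord41 * z))%R).
apply: (@goodr R12 (- (W ord41 ord42 * z))%R).
apply: (@good_diag _ u p z v) => //.
rewrite /= gE !mx4_mul.
have rE' : (c ^+ 2 * - (W ord42 ord41 * z) = - (r * z))%R by rewrite rE; ring.
have qE' : (c ^+ 2 * - (W ord41 ord42 * z) = - (q * z))%R by rewrite qE; ring.
have sE : (p * s = 1 + r * q)%R by rewrite -psrq; ring.
have sE' : (s = z * (1 + r * q))%R.
  by rewrite -sE mulrA [(z * p)%R]mulrC pz mul1r.
rewrite rE' qE' sE'; congr mx4; ring: pz.
Qed.

(** The middle block has determinant 1, so [p] and [r] generate the unit ideal and the stable range
    makes [p] a unit by one row operation. *)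
Let good_block (g : Sp4 A) u p q r s v :
  Sp4_val g = mx4 u 0 0 0  0 p q 0  0 r s 0  0 0 0 v -> good g.
Proof.
move=> gE Cg; have [W Wg] := congE Cg.
have uv : (u * v = 1)%R.
  by have := symplectic_rel g ord40 ord43; rewrite gE !mxE /= => <-; ring.
have psrq : (p * s - r * q = 1)%R.
  by have := symplectic_rel g ord41 ord42; rewrite gE !mxE /= => <-; ring.
have := Wg ord41 ord41; rewrite gE mxE /= => pE.
have := Wg ord42 ord41; rewrite gE mxE /= add0r => rE.
have [||| t [z tz]] := @stable_range p r s (- q)%R; try by eexists; eassumption.
  by rewrite -psrq; ring.
move: Cg; apply: (@goodl R12 t).
apply: (@good_unit_block _ u (p + c ^+ 2 * t * r) (q + c ^+ 2 * t * s)
  r s v z)%R => //.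
  by rewrite -psrq; ring.
by rewrite /= gE mx4_mul; congr mx4; ring.
Qed.

Let good_levi (g : Sp4 A) u p q f r s h v :
  Sp4_val g = mx4 u 0 0 0  0 p q f  0 r s h  0 0 0 v -> good g.
Proof.
move=> gE.
have e1 : (p * h - r * f = 0)%R.
  by have := symplectic_rel g ord41 ord43; rewrite gE !mxE /= => <-; ring.
have e2 : (q * h - s * f = 0)%R.
  by have := symplectic_rel g ord42 ord43; rewrite gE !mxE /= => <-; ring.
have e3 : (p * s - r * q = 1)%R.
  by have := symplectic_rel g ord41 ord42; rewrite gE !mxE /= => <-; ring.
have f0 : f = 0%R.
  rewrite -[f]mulr1 -e3.
  rewrite (_ : _ * _ = q * (p * h - r * f) - p * (q * h - s * f))%R; last by ring.
  by rewrite e1 e2 !mulr0 subr0.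
have h0 : h = 0%R.
  rewrite -[h]mulr1 -e3.
  rewrite (_ : _ * _ = s * (p * h - r * f) - r * (q * h - s * f))%R; last by ring.
  by rewrite e1 e2 !mulr0 subr0.
by apply: (@good_block g u p q r s v); rewrite gE f0 h0.
Qed.

(** The symplectic relations with the first column force the last row to be [(0, 0, 0, v)]. After
    the first row is cleared, [good_levi] deals with the rest of the last column. *)
Let good_parabolic (g : Sp4 A) :
  Sp4_val g ord41 ord40 = 0%R -> Sp4_val g ord42 ord40 = 0%R ->
  Sp4_val g ord43 ord40 = 0%R -> good g.
Proof.
move=> g10 g20 g30 Cg; have [W Wg] := congE Cg.
set u := Sp4_val g ord40 ord40; set v := Sp4_val g ord43 ord43.
have uv : (u * v = 1)%R.
  have := symplectic_rel g ord40 ord43; rewrite g10 g20 g30 -/u -/v mxE /= => <-.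
  by ring.
have z0 x : (u * x = 0)%R -> x = 0%R.
  move=> /(congr1 (fun y => v * y)%R).
  by rewrite mulrA [(v * u)%R]mulrC uv mul1r mulr0.
have g31 : Sp4_val g ord43 ord41 = 0%R.
  have := symplectic_rel g ord40 ord41; rewrite g10 g20 g30 -/u mxE /= => e.
  by apply: z0; rewrite -e; ring.
have g32 : Sp4_val g ord43 ord42 = 0%R.
  have := symplectic_rel g ord40 ord42; rewrite g10 g20 g30 -/u mxE /= => e.
  by apply: z0; rewrite -e; ring.
have := Wg ord40 ord41; rewrite add0r => aE.
have := Wg ord40 ord42; rewrite add0r => bE.
have := Wg ord40 ord43; rewrite add0r => dE.
move: Cg; apply: (@goodr R01 (- (v * W ord40 ord41))%R).
apply: (@goodr R02 (- (v * W ord40 ord42))%R).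
(* The second summand accounts for the change of the [(0, 3)] entry by the entry [- s] of [R01]. *)
apply: (@goodr R03 (- (v * (W ord40 ord43
  + v * W ord40 ord41 * (c ^+ 2 * W ord40 ord42))))%R).
eapply good_levi; rewrite /= [Sp4_val g]mx4_eta g10 g20 g30 g31 g32 aE bE dE.
rewrite -/u -/v !mx4_mul; congr mx4; try reflexivity; ring: uv.
Qed.

Let good_unit (g : Sp4 A) z : (Sp4_val g ord40 ord40 * z = 1)%R -> good g.
Proof.
move=> uz Cg; have [W Wg] := congE Cg.
have := Wg ord41 ord40; rewrite add0r => aE.
have := Wg ord42 ord40; rewrite add0r => bE.
have := Wg ord43 ord40; rewrite add0r => dE.
move: Cg; apply: (@goodl R10 (- (z * W ord41 ord40))%R).
apply: (@goodl R20 (- (z * W ord42 ord40))%R).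
apply: (@goodl R30 (- (z * (W ord43 ord40
  + z * W ord41 ord40 * (c ^+ 2 * W ord42 ord40))))%R).
apply: good_parabolic;
  rewrite /= [Sp4_val g]mx4_eta aE bE dE !mx4_mul !mxE /=; ring: uz.
Qed.

(** The first row of [g^-1] shows the first column of [g] to be unimodular. The stable range then
    makes its top entry a unit, and this entry clears the column. *)
Lemma cong_mx_generated : cong_mx (c ^+ 2)%R `<=` H.
Proof.
move=> g Cg; have [W Wg] := congE Cg.
have := Wg ord40 ord40 => /= uE.
have := Wg ord41 ord40; rewrite add0r => aE.
have := Wg ord42 ord40; rewrite add0r => bE.
have := Wg ord43 ord40; rewrite add0r => dE.
set x := Sp4_val g^-1 ord40.
have xg : (x ord40 * Sp4_val g ord40 ord40 + x ord41 * Sp4_val g ord41 ord40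
  + x ord42 * Sp4_val g ord42 ord40 + x ord43 * Sp4_val g ord43 ord40 = 1)%R.
  have := congr1 (fun h : Sp4 A => Sp4_val h ord40 ord40) (mulVg g).
  by rewrite /= !mxE sum_ord4.
have [||| t [z tz]] := @stable_range (Sp4_val g ord40 ord40)
  (x ord41 * Sp4_val g ord41 ord40
  + x ord42 * Sp4_val g ord42 ord40 + x ord43 * Sp4_val g ord43 ord40)%R
  (x ord40) 1%R.
- by exists (W ord40 ord40).
- exists (x ord41 * W ord41 ord40 + x ord42 * W ord42 ord40
         + x ord43 * W ord43 ord40)%R.
  by rewrite aE bE dE; ring.
- by rewrite -[RHS]xg; ring.
move: Cg; apply: (@goodl R01 (t * x ord41)%R).
apply: (@goodl R02 (t * x ord42)%R).
(* The second summand cancels the product of the two preceding parameters, which the entry [- s] of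
   [R01] brings into the top row. *)
apply: (@goodl R03 (t * x ord43 + c ^+ 2 * t * x ord41 * t * x ord42)%R).
apply: (@good_unit _ z).
by rewrite /= [Sp4_val g]mx4_eta !mx4_mul !mxE /= -[RHS]tz; ring.
Qed.

End Elimination.
End Generation.

(** * Congruence subgroups *)

Section CongruencePowers.
Variable A : comPzRingType.

(** The binomial expansion to first order: if [p] divides [c], a [p]-th power gains a factor [p] in
    the congruence. *)
Lemma cong_mxX (c : A) (g : Sp4 A) (W : 'M_4) m :
  Sp4_val g = 1%:M + c *: W ->
  exists V, Sp4_val (g ^+ m)%g = 1%:M + c *: (m%:R *: W + c *: V).
Proof.
move=> gE; elim: m => [|m [V VE]].
  by exists 0; rewrite scale0r scaler0 addr0 scaler0 addr0.
exists (W *m (m%:R *: W + c *: V) + V).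
rewrite expgS -[LHS]/(Sp4_val g *m Sp4_val (g ^+ m)%g) VE gE.
rewrite mulmxDl mul1mx mulmxDr mulmx1 -!scalemxAl -!scalemxAr -addrA.
congr (_ + _); rewrite !scalerDr !addrA mulrS scalerDl scale1r !scalerDr.
by rewrite addrAC addrC -!addrA; congr (_ + (_ + _)); exact: addrC.
Qed.

Lemma cong_mx_pow (p k : nat) (g : Sp4 A) :
  cong_mx (p%:R ^+ 1) g -> cong_mx (p%:R ^+ k.+1) (g ^+ (p ^ k))%g.
Proof.
move=> g1; elim: k => [|k [W IH]]; first by rewrite expn0 expg1.
rewrite expnSr expgM; have [V VE] := cong_mxX p IH.
exists (W + p%:R ^+ k *: V); rewrite VE; congr (_ + _).
rewrite [X in _ = X *: _]exprSr -scalerA.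
by rewrite [_ *: (W + _)]scalerDr [_ *: (_ *: V)]scalerA -exprS.
Qed.

Lemma cong_mx_dvd (c e : A) : cong_mx (c * e) `<=` cong_mx c.
Proof. by move=> g [W gW]; exists (e *: W); rewrite gW scalerA. Qed.

End CongruencePowers.

Lemma Zq_unitmx (q N : nat) (X Y : 'M['Z_q]_N) : X *m Y = 1%:M -> X \in unitmx.
Proof. by move=> /mulmx1_unit[]. Qed.

Section Reduction.
Variables (O : comPzRingType) (d : nat) (w : 'I_d.+1 -> O).
Variable lam : 'I_d.+1 -> {additive O -> int}.
Hypothesis basis_w : is_Zbasis w lam.
Variable l : prime_number.
Local Notation p := (val l).
Local Notation A := (tens O (Zp l)).

(** Restriction of scalars by the regular representation, block by block. The degree does not depend
    on [l], and for [n = 0] the coefficients form the field with [l] elements. *)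
Definition sp_red n (g : 'M[A]_4) :
    'M['Z_(p ^ n.+1)]_(\sum_(i < 4) d.+1) :=
  \mxblock_(i < 4, j < 4) map_mx (@Zp_red l n) (tens_mx w lam (g i j)).

Lemma sp_redM n (g h : 'M[A]_4) : sp_red n (g *m h) = sp_red n g *m sp_red n h.
Proof.
rewrite /sp_red mul_mxblock; apply/eq_mxblockP => i j.
rewrite mxE raddf_sum raddf_sum; apply: eq_bigr => k _ /=.
by rewrite (tens_mxM basis_w) map_mxM.
Qed.

Lemma sp_red1 n : sp_red n 1%:M = 1%:M.
Proof.
rewrite -mxdiagZ /mxdiag /sp_red; apply/eq_mxblockP => i j.
rewrite mxE; case: eqP => [e|_]; last by rewrite raddf0 map_mx0.
by rewrite conform_mx_id (tens_mx1 basis_w) map_mx1.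
Qed.

Lemma sp_red_unit n (g : Sp4 A) : sp_red n g \in unitmx.
Proof.
have h : sp_red n g *m sp_red n (Sp4_val (g^-1)%g) = 1%:M.
  by rewrite -sp_redM -[_ *m _]/(Sp4_val (g * g^-1)%g) mulgV sp_red1.
exact: Zq_unitmx h.
Qed.

Lemma sp_red_eq n (g h : Sp4 A) :
  sp_red n g = sp_red n h <-> cong_mx (p%:R ^+ n.+1) (g^-1 * h)%g.
Proof.
have E : sp_red n g = sp_red n h <-> sp_red n (Sp4_val (g^-1 * h)%g) = 1%:M.
  rewrite -[Sp4_val (g^-1 * h)%g]/(Sp4_val (g^-1)%g *m Sp4_val h) sp_redM.
  have gV : sp_red n (Sp4_val (g^-1)%g) *m sp_red n g = 1%:M.
    by rewrite -sp_redM -[_ *m _]/(Sp4_val (g^-1 * g)%g) mulVg sp_red1.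
  split=> [<- //|h1]; rewrite -[LHS]mulmx1 -h1 mulmxA.
  by rewrite (mulmx1C gV) mul1mx.
rewrite E; move: (g^-1 * h)%g => {E} {}g; split=> [|[W ->]].
  rewrite -(sp_red1 n) /sp_red => /eq_mxblockP gE.
  have /choice[W HW] : forall ij : 'I_4 * 'I_4, exists u,
      (Sp4_val g - 1%:M) ij.1 ij.2 = p%:R ^+ n.+1 * u.
    move=> [i j] /=; apply/(tens_dvdP basis_w) => k.
    set t : A := (Sp4_val g - 1%:M) i j.
    have t0 : map_mx (@Zp_red l n) (tens_mx w lam t) = 0.
      by rewrite /t mxE mxE raddfB raddfB /= gE subrr.
    have := tens_mx_mul w lam t (\col_j tcoord lam j 1).
    have -> : \sum_j pure (w j) ((\col_j tcoord lam j 1) j 0) = 1 :> A.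
      by rewrite [RHS](tcoordE basis_w); apply: eq_bigr => i' _; rewrite mxE.
    move=> /(_ k); rewrite mulr1 => <-.
    rewrite mxE raddf_sum big1 // => i' _.
    have := congr1 (fun M : 'M_d.+1 => M k i') t0; rewrite mxE [RHS]mxE => tk.
    by rewrite [LHS]rmorphM [X in X * _]tk mul0r.
  exists (\matrix_(i, j) W (i, j)); apply/matrixP => i j.
  by rewrite [RHS]mxE [X in _ + X]mxE [X in _ * X]mxE -(HW (i, j)) [X in _ + X]mxE
    [X in _ + (_ + X)]mxE addrC subrK.
rewrite -[RHS](sp_red1 n); apply/eq_mxblockP => i j.
rewrite mxE [in X in _ + X]mxE raddfD raddfD /= -[RHS]addr0; congr (_ + _).
apply/matrixP => a b; rewrite !mxE -mulrA tcoord_natXM.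
exact: Zp_red_dvd.
Qed.

End Reduction.

(** * Finite linear p-groups and Sylow subgroups *)

Section LinearPGroups.
Local Open Scope group_scope.

(* Let [A] be a maximal abelian normal subgroup.  It is diagonalisable, and   *)
(* [Q] permutes its at most [n.+1] weights, so [x ^+ (n.+1)`!] fixes each of  *)
(* them; hence [x ^+ (n.+1)`!] centralises [A], i.e. lies in [A].             *)
Lemma linear_pgroup_commute (K : closedFieldType) (n q : nat)
    (gT : finGroupType) (Q : {group gT}) (f : gT -> 'M[K]_n.+1) :
  q.-group Q -> (#|Q|%:R != 0 :> K)%R ->
  f 1 = 1%:M%R -> {in Q &, forall x y, f (x * y) = (f x *m f y)%R} ->
  {in Q &, injective f} ->
  {in Q &, forall x y, commute (x ^+ (n.+1)`!) (y ^+ (n.+1)`!)}.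
Proof.
move=> qQ Q0 f1 fM finj.
have [A maxA] : {A : {group gT} | [max A | A <| Q & abelian A]}.
  by apply: ex_maxgroup; exists 1%G; rewrite normal1 abelian1.
have /SCN_P[/andP[sAQ nAQ] cA] := max_SCN qQ maxA.
have abA : abelian A by have /maxgroupp/andP[] := maxA.
have inQ a : a \in A -> a \in Q by move/(fintype.subsetP sAQ).
have fX a k : a \in Q -> f (a ^+ k) = (f a ^+ k)%R.
  move=> aQ; elim: k => [|k IH]; first by rewrite expg0 f1 expr0.
  by rewrite expgS fM ?groupX // IH exprS.
have A0 : (#|A|%:R != 0 :> K)%R.
  apply: contra_neq Q0 => A0; have /dvdnP[k ->] := cardSg sAQ.
  by rewrite natrM A0 mulr0.
have [P Pu /allP Pdiag] : codiagonalizable [seq f a | a in A].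
  apply/codiagonalizableP; split.
    move=> _ _ /fintype.imageP[a aA ->] /fintype.imageP[b bA ->]; rewrite /comm_mx.
    by rewrite -!fM ?inQ // (centsP abA).
  move=> _ /fintype.imageP[a aA ->]; apply/diagonalizableP.
  (* [X ^ #|A| - 1] annihilates [f a] and is separable because [#|A|] is nonzero in [K]. *)
  have [rs rsE] := closed_field_poly_normal ('X^#|A| - 1 : {poly K}).
  rewrite (monicP (monic_Xn_sub_1 _ (cardG_gt0 A))) scale1r in rsE.
  exists rs; first by rewrite -separable_prod_XsubC -rsE separable_Xn_sub_1.
  rewrite -rsE mxminpoly_min // rmorphB rmorphXn /= horner_mx_X rmorph1.
  by rewrite -fX ?inQ // expg_cardG // f1 subrr.
have [chi chiE] : exists chi : 'I_n.+1 -> gT -> K,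
    forall i a, chi i a = (P *m f a *m invmx P)%R i i.
  by exists (fun i a => (P *m f a *m invmx P)%R i i).
have eigP i a : a \in A -> (row i P *m f a = chi i a *: row i P)%R.
  move=> aA; rewrite -row_mul.
  have /Pdiag : f a \in [seq f a | a in A] by exact: fintype.image_f.
  move=> /(similar_diagP _ Pu) dD.
  rewrite -[(P *m f a)%R](mulmxKV Pu); apply/rowP => j.
  rewrite mxE [LHS]mxE (bigD1 i) //= big1 => [|k ki].
    by rewrite addr0 [RHS]mxE [in RHS]mxE chiE.
  by rewrite dD ?mul0r // eq_sym.
have weightP (v : 'rV[K]_n.+1) psi : (v != 0)%R ->
    {in A, forall a, v *m f a = psi a *: v}%R ->
    exists j, {in A, forall a, psi a = chi j a}.
  move=> v0 vpsi; have [w vE] : exists w, v = (w *m P)%R.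
    by exists (v *m invmx P)%R; rewrite mulmxKV.
  have [j wj] : exists j, (w ord0 j != 0)%R.
    apply/existsP; apply: contraNT v0; rewrite negb_exists => /forallP w0.
    rewrite vE (_ : w = 0)%R ?mul0mx //; apply/rowP => j.
    by rewrite mxE; move: (w0 j) => /negPn/eqP.
  exists j => a aA; apply: (mulfI wj).
  have := vpsi a aA; rewrite vE -mulmxA.
  have -> : (P *m f a = diag_mx (\row_k chi k a) *m P)%R.
    apply/row_matrixP => i; rewrite row_mul eigP //; apply/rowP => k.
    by rewrite mul_diag_mx !mxE.
  rewrite mulmxA scalemxAl => /(congr1 (fun M => (M *m invmx P)%R)).
  rewrite !mulmxK // => /rowP/(_ j).
  by rewrite mul_mx_diag !mxE => ->; rewrite mulrC.
have expA x : x \in Q -> x ^+ (n.+1)`! \in A.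
  move=> xQ; rewrite -cA inE groupX //=.
  have conjA a k : a \in A -> a ^ (x ^+ k)^-1 \in A.
    by move=> aA; rewrite memJ_norm // groupV groupX // (fintype.subsetP nAQ).
  (* Each [row i P *m f (x ^+ k)] is a common eigenvector of [A]. For [n.+2] exponents [k] there are
     only [n.+1] characters [chi j], so two exponents share one; [e] is their difference. *)
  have chi_conj i : exists2 e, (0 < e <= n.+1)%N &
      {in A, forall a, chi i (a ^ (x ^+ e)^-1) = chi i a}.
    have /choice[j jP] : forall k : 'I_n.+2, exists j,
        {in A, forall a, chi i (a ^ (x ^+ k)^-1) = chi j a}.
      move=> k; apply: (@weightP (row i P *m f (x ^+ k)%g)%R
        (fun a => chi i (a ^ (x ^+ k)^-1))).
        apply: contraTneq (Pu) => h; rewrite -row_free_unit.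
        apply/negP => /row_freeP[B PB].
        have : (row i P = 0)%R.
          rewrite -[row i P]mulmx1 -f1 -(mulgV (x ^+ k)).
          by rewrite fM ?groupV ?groupX // mulmxA h mul0mx.
        move=> /(congr1 (fun v => (v *m B)%R ord0 i)).
        by rewrite -row_mul PB mul0mx !mxE eqxx => /eqP; rewrite oner_eq0.
      move=> a aA; have xk : x ^+ k \in Q by exact: groupX.
      rewrite -mulmxA -(fM (x ^+ k)) // ?inQ // conjgCV.
      rewrite fM // ?inQ ?conjA // mulmxA (eigP _ (a ^ _)) ?conjA //.
      by rewrite -scalemxAl.
    have /injectivePn[k1 [k2 k12 jk]] : ~~ injectiveb j.
      apply/negP => /injectiveP /leq_card.
      by rewrite !card_ord ltnn.
    wlog lt12 : k1 k2 k12 jk / (k1 < k2)%N.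
      move=> wl; have := k12; rewrite -val_eqE /= neq_ltn => /orP[] h.
        exact: (wl k1 k2).
      by apply: (wl k2 k1) => //; rewrite eq_sym.
    exists (k2 - k1)%N.
      by rewrite subn_gt0 lt12 /= leq_subLR (leq_trans _ (leq_addl _ _)) // -ltnS.
    move=> a aA; have h := jP k1 (a ^ (x ^+ k1)).
    have aA' : a ^ (x ^+ k1) \in A.
      by rewrite memJ_norm // groupX // (fintype.subsetP nAQ).
    have := jP k1 _ aA'; rewrite jk -(jP k2 _ aA') conjgK => ->.
    by rewrite -conjgM -[in RHS](subnK (ltnW lt12)) expgD invMg mulKVg.
  apply/centP => a aA; apply/esym/commgP/conjg_fixP.
  rewrite -{2}[a](conjgKV (x ^+ (n.+1)`!)); congr (_ ^ _).
  apply: finj; rewrite ?inQ ?conjA //.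
  have Pinj (M M' : 'M[K]_n.+1) : (P *m M = P *m M')%R -> M = M'.
    by move=> /(congr1 (fun M => invmx P *m M)%R); rewrite !mulKmx.
  apply: Pinj; apply/row_matrixP => i; rewrite !row_mul !eigP ?conjA //.
  congr (_ *: _)%R; have [e /andP[e0 en] eP] := chi_conj i.
  have /dvdnP[t ->] : (e %| (n.+1)`!)%N by rewrite dvdn_fact // e0.
  rewrite mulnC; elim: t a aA => [|t IH] a aA.
    by rewrite muln0 expg0 invg1 conjg1.
  by rewrite mulnSr expgD invMg conjgM -IH ?eP ?conjA.
move=> x y xQ yQ; apply: (centsP abA); exact: expA.
Qed.

End LinearPGroups.

Section FiniteGL.
Local Open Scope group_scope.

Local Lemma Fp_GL_pgroup_commute (r q N : nat)
    (Q : {group {'GL_N.+1['F_r]}}) : prime r -> prime q -> q != r ->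
  q.-group Q ->
  {in Q &, forall x y, commute (x ^+ (N.+1)`!)%g (y ^+ (N.+1)`!)%g}.
Proof.
move=> pr pq qr qQ.
have [K [j _]] := countable_algebraic_closure 'F_r.
have rK : r \in [pchar K] by rewrite (fmorph_pchar j) pchar_Fp.
apply: (@linear_pgroup_commute K N q _ Q (fun x => map_mx j (GLval x))) => //.
- rewrite -(dvdn_pcharf rK); have [k ->] := p_natP qQ.
  by rewrite Euclid_dvdX // dvdn_prime2 // negb_and eq_sym qr.
- by rewrite GL_1E map_mx1.
- by move=> x y _ _; rewrite GL_ME map_mxM.
- by move=> x y _ _ /map_mx_inj e; apply: val_inj.
Qed.

Lemma GL_Zp_pgroup_commute (r q N : nat)
    (Q : {group {'GL_N.+1['Z_r]}}) : prime r -> prime q -> q != r ->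
  q.-group Q ->
  {in Q &, forall x y, commute (x ^+ (N.+1)`!)%g (y ^+ (N.+1)`!)%g}.
Proof.
move=> pr; move: Q; have := @Fp_GL_pgroup_commute r q N.
by rewrite !(pdiv_id pr) => h Q; apply: h.
Qed.

(* [GL_N(Z/n)] as the image of a total function on matrices.                  *)
Lemma finite_GL (n N : nat) : (0 < N)%N ->
  exists (B : finGroupType) (phi : 'M['Z_n]_N -> B),
  [/\ {in unitmx &, forall X Y, phi (X *m Y)%R = phi X * phi Y},
      {in unitmx &, injective phi} &
      prime n -> forall q (Q : {group B}), prime q -> q != n -> q.-group Q ->
        {in Q &, forall x y, commute (x ^+ N`!)%g (y ^+ N`!)%g}].
Proof.
case: N => // N _; exists {'GL_N.+1['Z_n]}, (insubd (1 : {'GL_N.+1['Z_n]})).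
have E X : X \in unitmx -> GLval (insubd (1 : {'GL_N.+1['Z_n]}) X) = X.
  by move=> Xu; rewrite [LHS]insubdK.
split.
- move=> X Y Xu Yu; apply: val_inj; rewrite -[LHS]/(GLval _).
  rewrite E ?unitmx_mul ?Xu // -[RHS]/(GLval (_ * _)) GL_ME.
  by rewrite !E.
- by move=> X Y Xu Yu /(congr1 GLval); rewrite !E.
- by move=> pn q Q pq qn qQ; exact: (GL_Zp_pgroup_commute pn pq qn qQ).
Qed.

End FiniteGL.

(** * Lifting to [q]-groups by Sylow's theorem *)

Section SylowLifting.
Variables (G : groupType) (q : nat) (B2 : finGroupType) (f2 : G -> B2).
Local Open Scope group_scope.

(** Multiplicativity is asked on [H] only, since the reductions of adelic elements used later take a
    default value where the local component is not integral. *)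
Definition morph_on (gT : groupType) (H : set G) (f : G -> gT) : Prop :=
  forall g h, H g -> H h -> f (g * h) = f g * f h.

Lemma morph_on1 (gT : groupType) (H : set G) (f : G -> gT) :
  is_subgroup H -> morph_on H f -> f 1 = 1.
Proof.
move=> [H1 _] fM; have := fM _ _ H1 H1; rewrite mulg1 => h.
by apply: (mulgI (f 1)); rewrite -h mulg1.
Qed.

Lemma morph_onX (gT : groupType) (H : set G) (f : G -> gT) g k :
  is_subgroup H -> morph_on H f -> H g -> f (g ^+ k) = f g ^+ k.
Proof.
move=> sgH fM Hg; elim: k => [|k IH]; first by rewrite !expg0 (morph_on1 sgH).
by rewrite !expgS fM ?IH //; exact: subgroupX.
Qed.

Lemma morph_onV (gT : groupType) (H : set G) (f : G -> gT) g :
  is_subgroup H -> morph_on H f -> H g -> f g^-1 = (f g)^-1.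
Proof.
move=> sgH fM Hg; apply: (mulgI (f g)).
by rewrite -fM ?mulgV ?(morph_on1 sgH fM) //; exact: subgroupV.
Qed.

(** A Sylow [q]-subgroup of the image of [H] in [B1 * B2] maps onto one of the image in [B2]. That
    image is a [q]-group, so nothing is lost there, and [H'] is the preimage of the Sylow
    subgroup. *)
Lemma sylow_lift1 (H : set G) (B1 : finGroupType) (f1 : G -> B1)
    (P : {group B2}) :
  is_subgroup H -> morph_on H f1 -> morph_on H f2 ->
  q.-group P -> (forall g, H g -> f2 g \in P) ->
  exists H' : set G, [/\ is_subgroup H', H' `<=` H,
    forall g, H g -> exists2 g', H' g' & f2 g' = f2 g &
    exists2 Q : {group B1}, q.-group Q & forall g, H' g -> f1 g \in Q].
Proof.
move=> sgH f1M f2M qP HP.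
pose Z := [set z : B1 * B2 | `[< exists2 g, H g & z = (f1 g, f2 g) >]]%SET.
have gZ : group_set Z.
  apply/group_setP; split.
    rewrite inE; apply/asboolP; exists 1; first exact: subgroup1.
    by rewrite (morph_on1 sgH f1M) (morph_on1 sgH f2M).
  move=> x y; rewrite !inE => /asboolP[g Hg ->] /asboolP[h Hh ->].
  apply/asboolP; exists (g * h); first exact: subgroupM.
  by rewrite f1M // f2M.
have [S sylS] := Sylow_exists q (group gZ).
have sSZ := pHall_sub sylS.
exists [set g | H g /\ (f1 g, f2 g) \in S]; split.
- split.
    split; first exact: subgroup1.
    by rewrite (morph_on1 sgH f1M) (morph_on1 sgH f2M) (group1 S).
  move=> g h [Hg Sg] [Hh Sh]; have HhV := subgroupV sgH Hh.
  split; first exact: subgroupM.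
  rewrite f1M // f2M // (morph_onV sgH f1M) // (morph_onV sgH f2M) //.
  exact: (groupM Sg (groupVr Sh)).
- by move=> g [].
- move=> g Hg.
  have sylS2 : q.-Sylow(snd @* group gZ) (snd @* S).
    by apply: (morphim_pHall _ _ sylS); rewrite finset.subsetT.
  have qZ : q.-group (snd @* group gZ).
    apply: pgroupS qP; apply/fintype.subsetP => _ /morphimP[z _ + ->].
    by rewrite inE => /asboolP[h Hh ->]; exact: HP.
  have : f2 g \in snd @* S.
    rewrite (pHall_id sylS2 qZ); apply/morphimP.
    exists (f1 g, f2 g); rewrite ?inE //; apply/asboolP.
    by exists g.
  move=> /morphimP[z _ zS ->].
  have := fintype.subsetP sSZ _ zS; rewrite inE => /asboolP[h Hh zE].
  by exists h; [split=> //; rewrite -zE | rewrite zE].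
- exists (fst @* S)%G; first exact: morphim_pgroup (pHall_pgroup sylS).
  move=> g [Hg Sg]; apply/morphimP.
  by exists (f1 g, f2 g); rewrite ?inE.
Qed.

Lemma sylow_lift (I : eqType) (s : seq I) (H : set G)
    (B1 : I -> finGroupType) (f1 : forall i, G -> B1 i) (P : {group B2}) :
  is_subgroup H -> (forall i, i \in s -> morph_on H (f1 i)) -> morph_on H f2 ->
  q.-group P -> (forall g, H g -> f2 g \in P) ->
  exists H' : set G, [/\ is_subgroup H', H' `<=` H,
    forall g, H g -> exists2 g', H' g' & f2 g' = f2 g &
    forall i, i \in s ->
      exists2 Q : {group B1 i}, q.-group Q & forall g, H' g -> f1 i g \in Q].
Proof.
move=> sgH f1M f2M qP HP; elim: s f1M => [|i s IH] f1M.
  by exists H; split=> // g Hg; exists g.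
have [|H1 [sg1 H1H surj1 Q1]] := IH.
  by move=> j js; apply: f1M; rewrite inE js orbT.
have [| |||H2 [sg2 H2H1 surj2 Q2]] := @sylow_lift1 H1 _ (f1 i) P sg1.
- by move=> g h /H1H Hg /H1H Hh; apply: f1M; rewrite ?mem_head.
- by move=> g h /H1H Hg /H1H Hh; apply: f2M.
- exact: qP.
- by move=> g /H1H; apply: HP.
exists H2; split=> //; first exact: subset_trans H1H.
- move=> g /surj1[g' /surj2[g'' Hg'' e'] e].
  by exists g''; rewrite // e'.
- move=> j; rewrite inE => /predU1P[->//|/Q1[Q qQ hQ]].
  by exists Q => // g /H2H1; exact: hQ.
Qed.

End SylowLifting.

Section PGroupGeneration.
Local Open Scope group_scope.

(** The commutator [z] has [p]-power order because [[~ x ^+ n, y] = z ^+ n]. The group is then built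
    from [<[z]>] by adjoining [x] and [y], each normalising what precedes. *)
Lemma pgroup_gen2 (gT : finGroupType) (p k : nat) (x y : gT) : prime p ->
  x ^+ (p ^ k) = 1 -> y ^+ (p ^ k) = 1 ->
  commute x [~ x, y] -> commute y [~ x, y] ->
  p.-group <<[set x; y]%SET>>.
Proof.
move=> pp xp yp cxz cyz; set z := [~ x, y] in cxz cyz.
have p_cycle (u : gT) : u ^+ (p ^ k) = 1 -> p.-group <[u]>.
  move=> up; rewrite /pgroup -[#|_|]/(#[u]).
  have : (p.-nat (p ^ k))%N by rewrite pnatX pnat_id.
  by apply: pnat_dvd; rewrite order_dvdn up.
have pz : p.-group <[z]>.
  by apply: p_cycle; rewrite -commXg // xp comm1g.
have pK : p.-group (<[z]> <*> <[x]>).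
  have zx : <[x]> \subset 'N(<[z]>).
    by rewrite norms_cycle /conjg -cxz mulKg cycle_id.
  by rewrite norm_joinEr // pgroupM pz p_cycle.
have yN : <[y]> \subset 'N(<[z]> <*> <[x]>).
  rewrite cycle_subG inE joing_idl joing_idr -genJ gen_subG conjUg !conjg_set1.
  rewrite finset.subUset !finset.sub1set /conjg -cyz mulKg.
  have zK : z \in [set z]%SET <*> [set x]%SET by rewrite mem_gen // !inE eqxx.
  have xK : x \in [set z]%SET <*> [set x]%SET.
    by rewrite mem_gen // !inE eqxx orbT.
  apply/andP; split; first exact: zK.
  by rewrite -[y^-1 * _]/(x ^ y) conjg_mulR; exact: groupM.
have pG : p.-group (<[z]> <*> <[x]> <*> <[y]>).
  by rewrite norm_joinEr // pgroupM pK p_cycle.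
apply: pgroupS pG; rewrite gen_subG finset.subUset !finset.sub1set.
rewrite -!cycle_subG joing_subr andbT.
by apply: fintype.subset_trans (joing_subl _ _); exact: joing_subr.
Qed.

End PGroupGeneration.

(** * Local topology *)

(** One statement for two uses: level [n] at the prime [l] under study, and level 0 at the other
    primes. Only at level 0 is the quotient linear over a field, hence the guard on the last
    clause. *)
Lemma sp_finite_quotient (O : comPzRingType) (d : nat) (w : 'I_d.+1 -> O)
    (lam : 'I_d.+1 -> {additive O -> int}) (l : prime_number) (n : nat) :
  is_Zbasis w lam ->
  exists (B : finGroupType) (f : Sp4 (tens O (Zp l)) -> B),
  [/\ forall g h, f (g * h)%g = (f g * f h)%g,
      forall g h, f g = f h <-> cong_mx ((val l)%:R ^+ n.+1) (g^-1 * h)%g &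
      n = 0%N -> forall q (Q : {group B}), prime q -> q != val l ->
        (q.-group Q)%g ->
        {in Q &, forall x y, commute (x ^+ (\sum_(i < 4) d.+1)`!)%g
                                     (y ^+ (\sum_(i < 4) d.+1)`!)%g}].
Proof.
move=> bas.
have N0 : (0 < \sum_(i < 4) d.+1)%N by rewrite sum_nat_const card_ord.
have [B [phi [phiM phiI phiC]]] := finite_GL (val l ^ n.+1) N0.
exists B, (fun g => phi (sp_red w lam n g)); split.
- by move=> g h; rewrite -phiM ?sp_red_unit // -(sp_redM bas).
- move=> g h; rewrite -(sp_red_eq bas); split=> [|-> //].
  by apply: phiI; exact: sp_red_unit.
- move=> n0 q Q pq ql; apply: phiC => //; rewrite n0 expn1 //.
  exact: (valP l).
Qed.

Lemma fraction_numden (R : idomainType) (q : {fraction R}) :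
  exists2 y : R, y != 0 & exists x, q * tofrac y = tofrac x.
Proof.
elim/quotW: q => r; exists \d_r; first exact: denom_ratioP.
exists \n_r; apply/eqP.
rewrite -[_ * _]/(FracField.mul _ _) !piE FracField.equivfE /FracField.mulf.
by rewrite !numden_Ratio ?mulf_neq0 ?denom_ratioP ?oner_neq0 // !mulr1 mulrC.
Qed.

Lemma subbase_nbhs (T : choiceType) (D : set (set T)) (V : set T) (t : T) :
  (exists2 D', D' `<=` finI_from D id & \bigcup_(B in D') B = V) -> V t ->
  exists2 S : seq (set T), forall B, List.In B S -> D B /\ B t &
    forall x, (forall B, List.In B S -> B x) -> V x.
Proof.
move=> [D' sD <-] [B DB Bt]; have [S SD SB] := sD B DB.
have In_mem X : List.In X (finmap.enum_fset S) <-> X \in finmap.enum_fset S.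
  elim: (finmap.enum_fset S) => //= Y s IH; rewrite inE; split.
    by move=> [->|/IH->]; rewrite ?eqxx ?orbT.
  by move=> /predU1P[->|/IH]; [left | right].
exists (finmap.enum_fset S) => [X /In_mem XS|x hx].
  split; first exact: set_mem (SD X XS).
  by move: Bt; rewrite -SB; apply.
by exists B => //; rewrite -SB => X XS; apply: hx; apply/In_mem.
Qed.

Section Local.
Variables (K : fieldExtType rat) (d : nat) (w : 'I_d.+1 -> int_ring K).
Variable lam : 'I_d.+1 -> {additive int_ring K -> int}.
Hypothesis basis_w : is_Zbasis w lam.
Variable l : prime_number.
Local Notation p := (val l).
Local Notation OZ := (tens (int_ring K) (Zp l)).
Local Notation KQ := (KQ K l).

Lemma Zp_to_Qp_inj : injective (@Zp_to_Qp l).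
Proof. by move=> x y /eqP; rewrite tofrac_eq => /eqP. Qed.

Definition tens_emb : OZ -> KQ := tens_map (@Zp_to_Qp l).
HB.instance Definition _ := GRing.RMorphism.on tens_emb.

Lemma tens_emb_inj : injective tens_emb.
Proof. exact: (tens_map_inj basis_w Zp_to_Qp_inj). Qed.

Definition sp_emb : Sp4 OZ -> Gloc K l := Gcirc_map (K := K) (@Zp_to_Qp l).

Lemma sp_embE g i j : Sp4_val (sp_emb g) i j = tens_emb (Sp4_val g i j).
Proof. by rewrite /sp_emb /= mxE. Qed.

Lemma tens_emb_cong (m n : nat) (t : OZ) :
  tens_emb (m%:R + p%:R ^+ n * t) = m%:R + p%:R ^+ n * tens_emb t.
Proof. by rewrite rmorphD rmorphM rmorphXn !rmorph_nat. Qed.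

Lemma sp_emb_inj : injective sp_emb.
Proof.
move=> g h e; apply: val_inj; apply/matrixP => i j; apply: tens_emb_inj.
by rewrite -!sp_embE e.
Qed.

Lemma sp_embM g h : sp_emb (g * h)%g = (sp_emb g * sp_emb h)%g.
Proof. by apply: val_inj; rewrite /= map_mxM. Qed.

Lemma sp_emb1 : sp_emb 1%g = 1%g.
Proof. by apply: (mulgI (sp_emb 1)%g); rewrite -sp_embM !mulg1. Qed.

Lemma sp_embV g : sp_emb g^-1%g = (sp_emb g)^-1%g.
Proof. by apply: (mulgI (sp_emb g)); rewrite -sp_embM !mulgV sp_emb1. Qed.

Lemma sp_embX g n : sp_emb (g ^+ n)%g = (sp_emb g ^+ n)%g.
Proof.
by elim: n => [|n IH]; rewrite ?expg0 ?sp_emb1 // !expgS sp_embM IH.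
Qed.

(** Indexed without the shift of [sp_red], so that [Gam 0] is the group of all integral points. *)
Definition Gam n : set (Gloc K l) := sp_emb @` cong_mx (p%:R ^+ n).

Lemma Gam_emb n g : Gam n (sp_emb g) <-> cong_mx (p%:R ^+ n) g.
Proof. by split=> [[h hn /sp_emb_inj <-]|gn] //; exists g. Qed.

Lemma Gam_subgroup n : is_subgroup (Gam n).
Proof.
have sg := cong_mx_subgroup (p%:R ^+ n : OZ).
split; first by rewrite -sp_emb1; apply/Gam_emb; exact: subgroup1.
move=> _ _ [g gn <-] [h hn <-]; rewrite -sp_embV -sp_embM; apply/Gam_emb.
exact: sg.2.
Qed.

Lemma Gam_anti n k : (n <= k)%N -> Gam k `<=` Gam n.
Proof.
move=> nk _ [g gk <-]; apply/Gam_emb; move: gk.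
by rewrite -(subnKC nk) exprD; exact: cong_mx_dvd.
Qed.

Lemma Gam0 : Gam 0 = Gloc_int K l.
Proof.
apply/seteqP; split=> [_ [g _ <-]|_ [g _ <-]]; exists g => //.
by exists (Sp4_val g - 1%:M); rewrite expr0 scale1r addrC subrK.
Qed.

Lemma Gam_separated g : (forall n, Gam n g) -> g = 1%g.
Proof.
move=> gn; have [h _ hE] := gn 0%N; rewrite -hE -sp_emb1; congr sp_emb.
apply: val_inj => /=; apply/eqP; rewrite -subr_eq0; apply/eqP.
apply/matrixP => i j; rewrite [RHS]mxE; apply: (tens_separated basis_w) => n.
have /Gam_emb[W ->] : Gam n.+1 (sp_emb h) by rewrite hE.
by exists (W i j); rewrite addrC addKr mxE.
Qed.

Lemma Zp_dvd_pow (y : Zp l) : y != 0 -> exists N z, p%:R ^+ N = y * z.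
Proof.
move=> y0; have [n yn] : exists n, Zp_red n y != 0.
  apply: contrapT => h; case/eqP: y0; apply: Zp_eq => n.
  by rewrite raddf0; apply: contrapT => /eqP yn; apply: h; exists n.
elim: n y y0 yn => [|n IH] y y0 yn.
  by exists 0%N, y^-1; rewrite expr0 divrr // Zp_unitP.
have [y00|y00] := eqVneq (Zp_red 0 y) 0; last first.
  by exists 0%N, y^-1; rewrite expr0 divrr // Zp_unitP.
have [y' yE] := Zp_dvdP y00.
have [N [z zE]] : exists N z, p%:R ^+ N = y' * z.
  apply: IH.
    by apply: contra_neq y0 => y'0; rewrite yE y'0 mulr0.
  apply: contra_neq yn => /Zp_dvdP[u uE].
  by rewrite yE uE mulrA -exprD Zp_red_dvd.
by exists N.+1, z; rewrite yE expr1 -mulrA -zE exprS.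
Qed.

Lemma Qp_denominator (q : Qp l) : exists N z, p%:R ^+ N * q = Zp_to_Qp z.
Proof.
have [y y0 [x qy]] := fraction_numden q; have [N [z yz]] := Zp_dvd_pow y0.
have {}qy : q * Zp_to_Qp y = Zp_to_Qp x by [].
exists N, (x * z); rewrite rmorphM /= -qy -mulrA -rmorphM -yz.
by rewrite rmorphXn rmorph_nat mulrC.
Qed.

Lemma tens_emb_dvd n (t : KQ) :
  (forall i, exists z, tcoord lam i t = p%:R ^+ n * Zp_to_Qp z) ->
  exists s, t = p%:R ^+ n * tens_emb s.
Proof.
move=> /choice[z zE]; exists (\sum_i pure (w i) (z i)).
apply: (tcoord_inj basis_w) => i.
by rewrite zE tcoord_natXM tcoord_map (tcoord_sum basis_w).
Qed.

Lemma tens_denominator (t : KQ) : exists N s, p%:R ^+ N * t = tens_emb s.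
Proof.
have /choice[N HN] := fun i => Qp_denominator (tcoord lam i t).
exists (\sum_i N i)%N; have [|s sE] := @tens_emb_dvd 0 (p%:R ^+ (\sum_i N i) * t).
  move=> i; have [z zE] := HN i; rewrite expr0.
  exists (p%:R ^+ (\sum_(j | j != i) N j) * z).
  rewrite mul1r tcoord_natXM (bigD1 i) //= exprD mulrAC zE.
  by rewrite rmorphM rmorphXn rmorph_nat mulrC.
by exists s; rewrite sE expr0 mul1r.
Qed.

(** The relation [X^T J X = J] descends along the injection of [O (x) Z_l], and it provides the
    integral inverse [- J X^T J]. *)
Lemma sp_emb_lift (k : Gloc K l) (X : 'M[OZ]_4) :
  Sp4_val k = map_mx tens_emb X -> exists2 g, Sp4_val g = X & sp_emb g = k.
Proof.
move=> kX; have XJ : X^T *m sympJ OZ *m X = sympJ OZ.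
  suff inj (Y Z : 'M[OZ]_4) : map_mx tens_emb Y = map_mx tens_emb Z -> Y = Z.
    apply: inj.
    have mapJ : map_mx tens_emb (sympJ OZ) = sympJ KQ.
      apply/matrixP => i j; rewrite !mxE; case: ifP => _; last exact: rmorph0.
      by case: ifP => _; rewrite ?rmorphN rmorph1.
    rewrite !map_mxM mapJ -map_trmx -kX.
    by have := valP k => /asboolP[].
  move=> /matrixP YZ; apply/matrixP => i j; apply: tens_emb_inj.
  by have := YZ i j; rewrite !mxE.
have X'X : (- sympJ OZ *m X^T *m sympJ OZ) *m X = 1%:M.
  rewrite -!mulmxA [_ *m (_ *m X)]mulmxA XJ mulNmx mx4_sympJ mx4_mul mx4_1.
  by apply/matrixP => i j; move: i j; do 2!apply: ord4P; rewrite !mxE /=; ring.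
have Xsp : X \in @symplectic OZ.
  by apply/asboolP; split=> //; eexists; split; [exact: mulmx1C X'X | exact: X'X].
by exists (MkSp4 Xsp) => //; apply: val_inj.
Qed.

Lemma Qp_ball_open n (c : Qp l) :
  open [set x : Qp l | exists z, x - c = p%:R ^+ n * Zp_to_Qp z].
Proof.
move=> x [z xz]; exists n => z'; exists (z + z').
by rewrite addrAC xz -mulrDr rmorphD.
Qed.

Lemma coord_preimage_open (mu : {additive int_ring K -> int}) (V : set (Qp l)) :
  open V -> open (Defs.coord mu @^-1` V : set KQ).
Proof.
move=> oV; exists [set (Defs.coord mu @^-1` V : set KQ)].
  by move=> _ ->; apply: (finI_from1 id); exists mu, V.
by rewrite bigcup_set1.
Qed.

Lemma KQ_ball_nbhs n (t : KQ) :
  nbhs t [set t' : KQ | exists s, t' - t = p%:R ^+ n * tens_emb s].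
Proof.
have : nbhs t [set t' : KQ | forall i, exists z,
    Defs.coord (lam i) t' - Defs.coord (lam i) t = p%:R ^+ n * Zp_to_Qp z].
  apply: (@filter_forall KQ _ (fun i => [set t' | exists z,
    Defs.coord (lam i) t' - Defs.coord (lam i) t = p%:R ^+ n * Zp_to_Qp z])
    (nbhs t)) => i.
  apply: open_nbhs_nbhs; split.
    exact: (@coord_preimage_open (lam i) _ (@Qp_ball_open n (Defs.coord (lam i) t))).
  by exists 0; rewrite subrr rmorph0 mulr0.
apply: filterS => t' h; apply: tens_emb_dvd => i.
by have [z zE] := h i; exists z; rewrite raddfB.
Qed.

Lemma Gloc_ball_nbhs n (h : Gloc K l) :
  nbhs h [set h' : Gloc K l | forall i j, exists s,
    Sp4_val h' i j - Sp4_val h i j = p%:R ^+ n * tens_emb s].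
Proof.
apply: (@initial_continuous _ _ (val : Sp4 KQ -> 'M[KQ]_4) h
  [set M : 'M[KQ]_4 | forall i j, exists s,
    M i j - Sp4_val h i j = p%:R ^+ n * tens_emb s]).
exists (fun i j => [set t : KQ | exists s,
  t - Sp4_val h i j = p%:R ^+ n * tens_emb s]) => //.
by move=> i j; exact: KQ_ball_nbhs.
Qed.

(** [h^-1] may have a denominator [p ^ M], so [h'] must agree with [h] modulo [p ^ (M + n)] for
    [h^-1 * h'] to be 1 modulo [p ^ n]. *)
Lemma Gam_coset_open n g : open [set h | Gam n (g^-1 * h)%g].
Proof.
rewrite openE => h gh.
have /choice[N HN] := fun ij : 'I_4 * 'I_4 =>
  tens_denominator (Sp4_val (h^-1)%g ij.1 ij.2).
pose M := (\sum_ij N ij)%N.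
have denM i j : exists s, p%:R ^+ M * Sp4_val (h^-1)%g i j = tens_emb s.
  have [s sE] := HN (i, j); rewrite /= in sE.
  exists (p%:R ^+ (\sum_(ij | ij != (i, j)) N ij) * s).
  rewrite /M (bigD1 (i, j)) //= exprD mulrAC sE rmorphM rmorphXn rmorph_nat.
  by rewrite mulrC.
apply: filterS (Gloc_ball_nbhs (M + n) h) => h' h'h.
suff hh' : Gam n (h^-1 * h')%g.
  have := subgroupM (Gam_subgroup n) gh hh'.
  by rewrite -mulgA mulVKg.
have hh' i j : exists s,
    Sp4_val (h^-1 * h')%g i j - (1%:M : 'M[KQ]_4) i j = p%:R ^+ n * tens_emb s.
  have /choice[a aE] := denM i.
  have /choice[b bE] := fun m => h'h m j.
  exists (\sum_m a m * b m).
  have -> : tens_emb (\sum_m a m * b m) = \sum_m tens_emb (a m) * tens_emb (b m).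
    by rewrite rmorph_sum; apply: eq_bigr => m _; exact: rmorphM.
  rewrite mulr_sumr.
  rewrite -[1%:M i j]/(Sp4_val (1%g : Gloc K l) i j) -(mulVg h).
  rewrite -[Sp4_val (h^-1 * h')%g]/(Sp4_val (h^-1)%g *m Sp4_val h').
  rewrite -[Sp4_val (h^-1 * h)%g]/(Sp4_val (h^-1)%g *m Sp4_val h).
  rewrite !mxE -sumrB; apply: eq_bigr => m _.
  by rewrite -mulrBr bE exprD -aE; ring.
have /choice[s sE] := fun ij : 'I_4 * 'I_4 => hh' ij.1 ij.2.
have [|k kE <-] := @sp_emb_lift (h^-1 * h')%g
  (1%:M + p%:R ^+ n *: \matrix_(i, j) s (i, j)).
  apply/matrixP => i j; rewrite [RHS]mxE.
  have -> : (1%:M + p%:R ^+ n *: \matrix_(i, j) s (i, j)) i j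
      = (i == j)%:R + p%:R ^+ n * s (i, j) by rewrite !mxE.
  by rewrite tens_emb_cong -(sE (i, j)) [(1%:M : 'M[KQ]_4) _ _]mxE addrC subrK.
by apply/Gam_emb; exists (\matrix_(i, j) s (i, j)).
Qed.

Lemma KQ_nbhs_ball (t : KQ) (P : set KQ) : nbhs t P ->
  exists n, forall s, P (t + p%:R ^+ n * tens_emb s).
Proof.
rewrite nbhsE => -[V [oV Vt] VP].
have [S SD SV] := subbase_nbhs (D := @KQ_subbase K l) oV Vt.
suff [n nS] : exists n, forall s B, List.In B S -> B (t + p%:R ^+ n * tens_emb s).
  by exists n => s; apply: VP; apply: SV; exact: nS.
have /choice[N HN] : forall i : set KQ, exists n : nat, List.In i S ->
    forall k s, (n <= k)%N -> i (t + p%:R ^+ k * tens_emb s).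
  move=> i; have [iS|iS] := pselect (List.In i S); last by exists 0%N.
  have [[mu [V' [oV' iE]]] it] := SD i iS.
  have : V' (Defs.coord mu t) by move: it; rewrite iE.
  move=> /oV'[n nV']; exists n => _ k s nk.
  rewrite iE /preimage /= -[Defs.coord mu _]/(tcoord (fun _ : 'I_1 => mu) 0 _).
  rewrite raddfD /= tcoord_natXM tcoord_map -(subnKC nk) exprD -mulrA.
  have := nV' (p%:R ^+ (k - n) * tcoord (fun _ : 'I_1 => mu) 0 s).
  by rewrite rmorphM rmorphXn rmorph_nat.
exists (\sum_(i <- S) N i)%N => s i iS; apply: HN => //.
elim: S iS {SD SV} => //= B S IH [->|/IH h]; rewrite big_cons ?leq_addr //.
by rewrite (leq_trans h) // leq_addl.
Qed.

Lemma Gam_nbhs1 (V : set (Gloc K l)) : open V -> V 1%g ->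
  exists n, Gam n `<=` V.
Proof.
move=> [O oO <-] O1.
have [P P1 PO] : nbhs (Sp4_val (1%g : Gloc K l)) O.
  by apply: open_nbhs_nbhs; split.
have /choice[N HN] : forall ij : 'I_4 * 'I_4, exists n, forall s,
    P ij.1 ij.2 ((ij.1 == ij.2)%:R + p%:R ^+ n * tens_emb s).
  by move=> [i j]; apply: KQ_nbhs_ball; have := P1 i j; rewrite mxE.
pose k := (\sum_ij N ij)%N; exists k => _ [g [W gW] <-].
apply: PO => i j; rewrite sp_embE.
have -> : Sp4_val g i j = (i == j)%:R + p%:R ^+ k * W i j by rewrite gW !mxE.
have kE : k = (N (i, j) + \sum_(ij | ij != (i, j)) N ij)%N.
  by rewrite /k (bigD1 (i, j)).
have := HN (i, j) (p%:R ^+ (\sum_(ij | ij != (i, j)) N ij) * W i j).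
by rewrite -tens_emb_cong mulrA -exprD -kE.
Qed.

End Local.

(** * Adelic points *)

(* [compact_cover] is only stated for pointed spaces. *)
HB.instance Definition _ (K : fieldExtType rat) (L : set prime_number) :=
  isPointed.Build (Gadele K L) 1%g.

Section Adelic.
Variables (K : fieldExtType rat) (d : nat) (w : 'I_d.+1 -> int_ring K).
Variable lam : 'I_d.+1 -> {additive int_ring K -> int}.
Hypothesis basis_w : is_Zbasis w lam.
Variables (L : set prime_number) (U : set (Gadele K L)).
Hypothesis sgU : is_subgroup U.
Hypothesis openU : forall l : L, open (Gproj l @` U).
Hypothesis fullU :
  finite_set [set l : L | Gproj l @` U <> Gloc_int K (set_val l)].

Local Notation Gl l := (Gloc K (set_val l)).
Local Notation OZ l := (tens (int_ring K) (Zp (set_val l))).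
Local Notation q l := (val (set_val l)).
Local Open Scope group_scope.

Lemma GprojM (l : L) (g h : Gadele K L) : Gproj l (g * h) = Gproj l g * Gproj l h.
Proof. by apply: val_inj; rewrite /= map_mxM. Qed.

Lemma Gproj1 (l : L) : Gproj l (1 : Gadele K L) = 1.
Proof. by apply: (mulgI (Gproj l 1)); rewrite -GprojM !mulg1. Qed.

Lemma GprojV (l : L) (g : Gadele K L) : Gproj l g^-1 = (Gproj l g)^-1.
Proof. by apply: (mulgI (Gproj l g)); rewrite -GprojM !mulgV Gproj1. Qed.

Lemma GprojX (l : L) (g : Gadele K L) n : Gproj l (g ^+ n) = Gproj l g ^+ n.
Proof.
by elim: n => [|n IH]; rewrite ?expg0 ?Gproj1 // !expgS GprojM IH.
Qed.

Definition Uproj (l : L) : set (Gl l) := Gproj l @` U.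
Arguments Uproj : clear implicits.

Lemma Uproj_subgroup l : is_subgroup (Uproj l).
Proof.
split; first by exists 1; [exact: subgroup1 | exact: Gproj1].
move=> _ _ [g Ug <-] [h Uh <-]; exists (g * h^-1); first exact: sgU.2.
by rewrite GprojM GprojV.
Qed.

Definition bad : set L := [set l | Uproj l <> Gloc_int K (set_val l)].

Lemma Uproj_good l : ~ bad l -> Uproj l = Gloc_int K (set_val l).
Proof. exact: contrapT. Qed.

Lemma restricted_box_open (B : set (Gadele K L)) : restricted_box B -> open B.
Proof.
move=> boxB; exists [set B]; last by rewrite bigcup_set1.
by move=> _ ->; exact: (finI_from1 id).
Qed.

Lemma restricted_boxI (A B : set (Gadele K L)) :
  restricted_box A -> restricted_box B -> restricted_box (A `&` B).
Proof.
move=> [V [oV fV ->]] [W [oW fW ->]]; exists (fun l => V l `&` W l); split.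
- by move=> l; exact: openI.
- have : finite_set ([set l | V l <> Gloc_int K (set_val l)]
      `|` [set l | W l <> Gloc_int K (set_val l)]) by rewrite finite_setU.
  apply: sub_finite_set => l /= VW.
  have [Vl|] := pselect (V l = Gloc_int K (set_val l)); last by left.
  by right => Wl; apply: VW; rewrite Vl Wl setIid.
- apply/seteqP; split=> g /= => [[gV gW] l|gVW]; first by split.
  by split=> l; have [] := gVW l.
Qed.

(** The whole group is in general not a restricted box, so the intersection of finitely many boxes
    starts from a given box [A]. *)
Lemma nbhs_box (V : set (Gadele K L)) (A : set (Gadele K L)) (g : Gadele K L) :
  open V -> V g -> restricted_box A -> A g ->
  exists2 B, restricted_box B & B g /\ B `<=` V.
Proof.
move=> oV Vg boxA Ag.
have [S SD SV] := subbase_nbhs (D := @restricted_box K L) oV Vg.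
suff [B boxB [Bg BS]] : exists2 B, restricted_box B &
    B g /\ forall x, B x -> forall C, List.In C S -> C x.
  by exists B => //; split=> // x /BS; exact: SV.
elim: S SD {SV} => [|C S IH] SD; first by exists A.
have [|B boxB [Bg BS]] := IH; first by move=> X XS; apply: SD; right.
have [boxC Cg] := SD C (or_introl erefl).
exists (C `&` B); first exact: restricted_boxI.
by split=> // x [Cx Bx] X [<-|XS] //; exact: BS.
Qed.

(** The sets [Uproj s] are open and almost all integral, which makes this a box for open [V]; on
    elements of [U] it imposes only the condition at [r]. *)
Definition local_box (r : L) (V : set (Gl r)) : set (Gadele K L) :=
  [set g | V (Gproj r g) /\ forall s, Uproj s (Gproj s g)].

Lemma local_box_box r V : open V -> restricted_box (local_box (r := r) V).
Proof.
move=> oV; exists (dfwith Uproj r (Uproj r `&` V)); split.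
- move=> l; case: dfwithP => [|j _]; last exact: openU.
  by apply: openI => //; exact: openU.
- have : finite_set ([set r] `|` bad) by rewrite finite_setU.
  apply: sub_finite_set => l /=; by case: dfwithP => [|j _ h]; [left | right].
- apply/seteqP; split=> g /= => [[gV gU] l|h].
    by case: dfwithP.
  split; first by have := h r; rewrite dfwithin => -[].
  move=> s; have := h s; case: dfwithP => //.
  by case.
Qed.

Local Notation emb l := (@sp_emb K (set_val l)).
Local Notation Gamma l := (@Gam K (set_val l)).

Hypothesis compactU : compact U.

Lemma local_box_coset (r : L) n g : U g ->
  restricted_box (local_box (r := r) [set h | Gamma r n ((Gproj r g)^-1 * h)])
  /\ local_box (r := r) [set h | Gamma r n ((Gproj r g)^-1 * h)] g.
Proof.
move=> Ug; split.
  by apply: local_box_box; apply: (Gam_coset_open basis_w).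
split=> [|s]; last by exists g.
by rewrite /= mulVg; exact: subgroup1 (Gam_subgroup basis_w _ _).
Qed.

(** By compactness [k] cosets of [Gamma r 1] cover the projection of [U]. Two of the powers
    [u ^+ 0], ..., [u ^+ k] share a coset, and the difference of their exponents divides the
    factorial of [k]. *)
Lemma power_in_Gamma (r : L) : exists2 M, (0 < M)%N &
  forall u, U u -> Gamma r 1 (Gproj r u ^+ M).
Proof.
have : cover_compact U by rewrite -compact_cover.
move=> /(_ (Gadele K L) U
  (fun g => local_box (r := r) [set h | Gamma r 1 ((Gproj r g)^-1 * h)])).
case.
- by move=> g /(local_box_coset r 1)[/restricted_box_open].
- by move=> g Ug; exists g => //; have [] := local_box_coset r 1 Ug.
move=> D DU coverD; pose k := size (finmap.enum_fset D).
exists (k`!)%N; first exact: fact_gt0.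
move=> u Uu; have sgG := Gam_subgroup basis_w (set_val r) 1.
have /choice[f fP] : forall i : 'I_k.+1, exists j : 'I_k,
    Gamma r 1 ((Gproj r (nth 1 (finmap.enum_fset D) j))^-1 * Gproj r (u ^+ i)).
  move=> i; have /coverD[g gD [gu _]] : U (u ^+ i) by exact: subgroupX.
  have gi : (index g (finmap.enum_fset D) < k)%N by rewrite index_mem.
  by exists (Ordinal gi); rewrite /= nth_index.
have /injectivePn[i [j ij fij]] : ~~ injectiveb f.
  by apply/negP => /injectiveP/leq_card; rewrite !card_ord ltnn.
wlog lt_ij : i j ij fij / (i < j)%N.
  move=> wl; have := ij; rewrite -val_eqE /= neq_ltn => /orP[] h.
    exact: (wl i j).
  by apply: (wl j i) => //; rewrite eq_sym.
have h : Gamma r 1 (Gproj r u ^+ (j - i)).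
  have := subgroupM sgG (subgroupV sgG (fP i)) (fP j).
  rewrite -fij invMg invgK -mulgA mulKVg -GprojV -GprojM.
  by rewrite -{1}(subnKC (ltnW lt_ij)) expgD mulKg GprojX.
have /dvdnP[t ->] : (j - i %| k`!)%N.
  rewrite dvdn_fact // subn_gt0 lt_ij /= leq_subLR (leq_trans _ (leq_addl _ _)) //.
  by rewrite -ltnS.
by rewrite mulnC expgM; exact: subgroupX.
Qed.

(* The group [N_l] of the introduction. *)
Definition slice (l : L) : set (Sp4 (OZ l)) :=
  [set h | exists2 u, U u &
     Gproj l u = emb l h /\ forall r, r <> l -> Gproj r u = 1].
Arguments slice : clear implicits.

Lemma slice_subgroup l : is_subgroup (slice l).
Proof.
split.
  exists 1; first exact: subgroup1.
  by rewrite sp_emb1 Gproj1; split=> // r _; exact: Gproj1.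
move=> g h [u Uu [ul ur]] [v Uv [vl vr]].
exists (u * v^-1); first exact: sgU.2.
rewrite GprojM GprojV ul vl -sp_embV -sp_embM; split=> // r rl.
by rewrite GprojM GprojV ur // vr // invg1 mulg1.
Qed.

Lemma slice_conj l g h : Uproj l (emb l g) -> slice l h -> slice l (g * h * g^-1).
Proof.
move=> [v Uv vg] [u Uu [ul ur]].
exists (v * u * v^-1).
  by apply: (subgroupM sgU); [exact: subgroupM | exact: subgroupV].
rewrite !GprojM !GprojV vg ul -sp_embV -!sp_embM; split=> // r rl.
by rewrite !GprojM GprojV ur // mulg1 mulgV.
Qed.

(** The sets [C (n, R)] form a filter base on [U]. A cluster point exists by compactness, and its
    components are exactly [z] and 1 since the congruence subgroups meet trivially. *)
Lemma slice_limit (l : L) (z : Sp4 (OZ l)) :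
  (forall n (R : seq L), l \notin R -> exists c, [/\ U c,
     Gamma l n ((emb l z)^-1 * Gproj l c) &
     forall r, r \in R -> Gamma r n (Gproj r c)]) ->
  slice l z.
Proof.
move=> approx.
pose C (nR : nat * seq L) := [set c : Gadele K L | [/\ U c,
  Gamma l nR.1 ((emb l z)^-1 * Gproj l c) &
  forall r, r \in nR.2 -> Gamma r nR.1 (Gproj r c)]].
pose D := [set nR : nat * seq L | l \notin nR.2].
have FC : ProperFilter (filter_from D C).
  apply: filter_from_proper; last first.
    by move=> [n R] lR; have [c hc] := approx n R lR; exists c.
  apply: filter_from_filter; first by exists (0%N, [::]).
  move=> [n R] [n' R'] /= lR lR'; exists (maxn n n', R ++ R').
    by rewrite /D /= mem_cat negb_or lR lR'.
  move=> c /= [Uc cl cR]; split; split=> //=.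
  - by apply: (Gam_anti basis_w) cl; exact: leq_maxl.
  - move=> r rR; apply: (Gam_anti basis_w (k := maxn n n')); first exact: leq_maxl.
    by apply: cR; rewrite mem_cat rR.
  - by apply: (Gam_anti basis_w) cl; exact: leq_maxr.
  - move=> r rR; apply: (Gam_anti basis_w (k := maxn n n')); first exact: leq_maxr.
    by apply: cR; rewrite mem_cat rR orbT.
have [|p [Up clp]] := compactU FC.
  by exists (0%N, [::]) => // c [].
have near r n R : l \notin R -> exists2 c, C (n, R) c &
    Gamma r n ((Gproj r p)^-1 * Gproj r c).
  move=> lR; have [boxp Wp] := local_box_coset r n Up.
  have FC' : filter_from D C (C (n, R)) by exists (n, R).
  have nbhs_p : nbhs p (local_box (r := r)
      [set h | Gamma r n ((Gproj r p)^-1 * h)]).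
    by apply: open_nbhs_nbhs; split=> //; exact: restricted_box_open.
  have [c [hc [hcr _]]] := clp _ _ FC' nbhs_p.
  by exists c.
exists p => //; split.
  suff : (emb l z)^-1 * Gproj l p = 1.
    by move=> /(congr1 (mulg (emb l z))); rewrite mulKVg mulg1.
  apply: (Gam_separated basis_w) => n.
  have [//|c [Uc cz _] cp] := near l n [::].
  have sgG := Gam_subgroup basis_w (set_val l) n.
  have := subgroupM sgG cz (subgroupV sgG cp).
  by rewrite invMg invgK -mulgA mulKVg.
move=> r rl; apply: (Gam_separated basis_w) => n.
have [|c [Uc _ cr] cp] := near r n [:: r].
  by rewrite inE eq_sym; apply/eqP.
have sgG := Gam_subgroup basis_w (set_val r) n.
have := subgroupM sgG (cr r (mem_head _ _)) (subgroupV sgG cp).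
by rewrite invMg invgK mulKVg.
Qed.

(** * Commutators of lifts *)

Definition sp_lift (l : L) (g : Gl l) : Sp4 (OZ l) := xget 1 [set h | emb l h = g].

Lemma sp_liftK l : cancel (emb l) (@sp_lift l).
Proof.
move=> h; rewrite /sp_lift; case: xgetP => [k _ /= kh|]; last by move=> /(_ h); case.
exact: (sp_emb_inj basis_w) kh.
Qed.

Local Notation nblocks := (\sum_(i < 4) d.+1)%N.

(* Sylow's theorem lifts [x] and [y], to any finite level, to elements [u],   *)
(* [v] of [U] whose reductions at the good primes in [R] generate an          *)
(* [l]-group; there [u ^+ m] and [v ^+ m] commute.                            *)
Lemma lift_to_pgroup (l : L) (x y : Sp4 (OZ l)) n m (R : seq L) :
  (nblocks`! %| m)%N -> l \notin R -> (forall r, r \in R -> ~ bad r) ->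
  Uproj l (emb l x) -> Uproj l (emb l y) ->
  cong_mx ((q l)%:R ^+ n.+1)%R (x ^+ (q l ^ n.+1)) ->
  cong_mx ((q l)%:R ^+ n.+1)%R (y ^+ (q l ^ n.+1)) ->
  commute x [~ x, y] -> commute y [~ x, y] ->
  exists u v : Gadele K L, [/\ U u, U v,
    exists2 h, Gproj l u = emb l h & cong_mx ((q l)%:R ^+ n.+1)%R (x^-1 * h),
    exists2 h, Gproj l v = emb l h & cong_mx ((q l)%:R ^+ n.+1)%R (y^-1 * h) &
    (exists k, cong_mx ((q l)%:R ^+ n.+1)%R
      ((x ^+ m * y ^+ m * (x ^+ m)^-1 * (y ^+ m)^-1) ^+ (q l ^ k))) /\
    forall r, r \in R ->
      Gamma r 1 (Gproj r (u ^+ m * v ^+ m * (u ^+ m)^-1 * (v ^+ m)^-1))].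
Proof.
move=> /dvdnP[m' mE] lR goodR Ux Uy xn yn cx cy.
have [B2 [f2 [f2M f2E _]]] := sp_finite_quotient (set_val l) n basis_w.
pose S (r : L) := cid (sp_finite_quotient (set_val r) 0 basis_w).
pose B1 (r : L) := projT1 (S r).
pose f1 (r : L) := projT1 (cid (projT2 (S r))) : Sp4 (OZ r) -> B1 r.
have f1P r : [/\ forall g h, f1 r (g * h) = f1 r g * f1 r h,
      forall g h, f1 r g = f1 r h <-> cong_mx ((q r)%:R ^+ 1)%R (g^-1 * h) &
      0%N = 0%N -> forall p (Q : {group B1 r}), prime p -> p != q r ->
        (p.-group Q) ->
        {in Q &, forall x y, commute (x ^+ nblocks`!) (y ^+ nblocks`!)}].
  exact: projT2 (cid (projT2 (S r))).
have f21 : f2 1 = 1 by apply: (mulgI (f2 1)); rewrite -f2M !mulg1.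
have f2V g : f2 g^-1 = (f2 g)^-1.
  by apply: (mulgI (f2 g)); rewrite -f2M !mulgV f21.
have f2X g j : f2 (g ^+ j) = f2 g ^+ j.
  by elim: j => [|j IH]; rewrite ?expg0 // !expgS f2M IH.
have f2R : f2 [~ x, y] = [~ f2 x, f2 y].
  by rewrite /commg /conjg !f2M !f2V.
have f2n g : cong_mx ((q l)%:R ^+ n.+1)%R (g ^+ (q l ^ n.+1)) ->
    f2 g ^+ (q l ^ n.+1) = 1.
  move=> gn; rewrite -f2X -f21; apply/esym/f2E.
  by rewrite invg1 mul1g.
pose P := <<[set f2 x; f2 y]%SET>>%G.
have pP : (q l).-group P.
  apply: (@pgroup_gen2 _ _ n.+1) (valP (set_val l)) (f2n _ xn) (f2n _ yn) _ _.
    by rewrite /commute -f2R -!f2M cx.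
  by rewrite /commute -f2R -!f2M cy.
have xP : f2 x \in P by rewrite mem_gen // !inE eqxx.
have yP : f2 y \in P by rewrite mem_gen // !inE eqxx orbT.
(* Only the [l]-component needs a restriction: the primes in [R] are good, so the components there
   are integral on all of [U]. *)
pose H0 := [set u | U u /\ exists2 h, Gproj l u = emb l h & f2 h \in P].
have sgH0 : is_subgroup H0.
  split.
    split; first exact: subgroup1.
    by exists 1; [rewrite Gproj1 sp_emb1 | rewrite f21 (group1 P)].
  move=> g h [Ug [g' gE gP]] [Uh [h' hE hP]]; split; first exact: sgU.2.
  exists (g' * h'^-1); first by rewrite GprojM GprojV gE hE -sp_embV -sp_embM.
  by rewrite f2M f2V groupM ?groupV.
pose F2 u := f2 (sp_lift (Gproj l u)).
pose F1 r u := f1 r (sp_lift (Gproj r u)).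
have F2M : morph_on H0 F2.
  move=> g h [_ [g' gE _]] [_ [h' hE _]].
  by rewrite /F2 GprojM gE hE -sp_embM !sp_liftK f2M.
have goodE r u : r \in R -> U u -> exists h, Gproj r u = emb r h.
  move=> /goodR/Uproj_good rE Uu.
  have : Uproj r (Gproj r u) by exists u.
  by rewrite rE => -[h _ <-]; exists h.
have F1M r : r \in R -> morph_on H0 (F1 r).
  move=> rR g h [/(goodE _ _ rR)[g' gE] _] [/(goodE _ _ rR)[h' hE] _].
  rewrite /F1 GprojM gE hE -sp_embM !sp_liftK.
  by have [f1M _ _] := f1P r; rewrite f1M.
have [|H' [sgH' H'H0 surj Q1]] := sylow_lift sgH0 F1M F2M pP.
  by move=> g [_ [h hE hP]]; rewrite /F2 hE sp_liftK.
have lift z : Uproj l (emb l z) -> f2 z \in P -> exists2 u, H' u & F2 u = f2 z.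
  move=> [u0 Uu0 u0z] zP; have [|u H'u uE] := surj u0.
    by split=> //; exists z.
  by exists u => //; rewrite uE /F2 u0z sp_liftK.
have liftE z u : H' u -> F2 u = f2 z ->
    exists2 h, Gproj l u = emb l h & cong_mx ((q l)%:R ^+ n.+1)%R (z^-1 * h).
  move=> /H'H0[_ [h hE _]]; rewrite /F2 hE sp_liftK => hz.
  by exists h => //; apply/f2E.
have [u H'u uE] := lift x Ux xP.
have [v H'v vE] := lift y Uy yP.
exists u, v; split.
- by have [] := H'H0 u H'u.
- by have [] := H'H0 v H'v.
- exact: liftE.
- exact: liftE.
split=> [|r rR].
  have [j PE] := p_natP pP; exists j; set z := _ * _.
  have zP : f2 z \in P.
    by rewrite /z !f2M !f2V !f2X !groupM ?groupV ?groupX.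
  have : f2 1 = f2 (z ^+ (q l ^ j)) by rewrite f21 f2X -PE expg_cardG.
  by move/f2E; rewrite invg1 mul1g.
have [f1M f1E f1C] := f1P r; have [Q qQ QP] := Q1 r rR.
have ql_neq : q l != q r.
  by apply: contraNneq lR => /val_inj/val_inj->.
have comm : commute (F1 r u ^+ m) (F1 r v ^+ m).
  rewrite mE mulnC !expgM; apply: commuteX2.
  exact: (f1C erefl _ _ (valP (set_val l)) ql_neq qQ) (QP _ H'u) (QP _ H'v).
set c := _ * _; have H'c : H' c.
  have H'X g : H' g -> H' (g ^+ m) by exact: subgroupX.
  by do !(apply: (subgroupM sgH') || apply: (subgroupV sgH') || apply: H'X).
have F1H' : morph_on H' (F1 r) by move=> g h /H'H0 Hg /H'H0; exact: F1M.
have F1c : F1 r c = 1.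
  have H'X g : H' g -> H' (g ^+ m) by exact: subgroupX.
  have H'V g : H' g -> H' g^-1 by exact: subgroupV.
  have H'M g h : H' g -> H' h -> H' (g * h) by exact: subgroupM.
  rewrite /c !F1H' ?(morph_onV sgH' F1H') ?(morph_onX _ sgH' F1H'); auto 6.
  by rewrite comm mulgK mulgV.
have [h cE] := goodE r c rR (H'H0 c H'c).1.
rewrite cE; apply/(Gam_emb basis_w).
have : f1 r 1 = f1 r h.
  rewrite (_ : f1 r 1 = 1); last by apply: (mulgI (f1 r 1)); rewrite -f1M !mulg1.
  by rewrite -F1c /F1 cE sp_liftK.
by move/f1E; rewrite invg1 mul1g.
Qed.

Lemma Gamma_pow (r : L) k (g : Gl r) : Gamma r 1 g -> Gamma r k (g ^+ (q r ^ k)).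
Proof.
move=> [h h1 <-]; rewrite -sp_embX; apply: (Gam_anti basis_w (leqnSn k)).
by apply/(Gam_emb basis_w); exact: cong_mx_pow.
Qed.

(* The [r]-components of [c] lie in the pro-[r] groups [Gamma r 1], so a      *)
(* suitable power of [c] is close to [1] at every [r] without moving the      *)
(* [l]-component, which is pro-[l].                                           *)
Lemma slice_comm : exists2 m, (0 < m)%N &
  forall (l : L) (x y : Sp4 (OZ l)),
    Uproj l (emb l x) -> Uproj l (emb l y) ->
    (forall n, cong_mx ((q l)%:R ^+ n.+1)%R (x ^+ (q l ^ n.+1))) ->
    (forall n, cong_mx ((q l)%:R ^+ n.+1)%R (y ^+ (q l ^ n.+1))) ->
    commute x [~ x, y] -> commute y [~ x, y] ->
    slice l (x ^+ m * y ^+ m * (x ^+ m)^-1 * (y ^+ m)^-1).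
Proof.
have /choice[M MP] : forall r : L, exists M : nat, (0 < M)%N /\
    forall u, U u -> Gamma r 1 (Gproj r u ^+ M).
  by move=> r; have [M M0 MP] := power_in_Gamma r; exists M.
have /finite_seqP[sb badE] : finite_set bad by exact: fullU.
(* The factorial serves the good primes, through the commutation in linear [l]-groups; the factor
   [M r] brings [m]-th powers into [Gamma r 1] at the bad prime [r]. *)
exists (nblocks`! * \prod_(r <- sb) M r)%N.
  rewrite muln_gt0 fact_gt0 /= big_seq.
  by apply: prodn_cond_gt0 => r _; have [] := MP r.
set m := (_ * _)%N => l x y Ux Uy xn yn cx cy.
set z := x ^+ m * _ * _ * _.
apply: slice_limit => n R lR.
pose Rg := [seq r <- R | r \notin sb].
have [|||u [v [Uu Uv [h uE hx] [h' vE h'y] [[k zk] uvR]]]] :=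
  @lift_to_pgroup l x y n m Rg _ _ _ Ux Uy (xn n) (yn n) cx cy.
- exact: dvdn_mulr.
- by rewrite mem_filter negb_and lR orbT.
- move=> r; rewrite mem_filter => /andP[rsb _] rbad.
  by move/negP: rsb; apply; have := rbad; rewrite badE.
set c := u ^+ m * v ^+ m * (u ^+ m)^-1 * (v ^+ m)^-1.
have Uc : U c.
  have UX g j : U g -> U (g ^+ j) by exact: subgroupX.
  have UV g : U g -> U g^-1 by exact: subgroupV.
  by do !apply: (subgroupM sgU); auto.
have c1 r : r \in R -> Gamma r 1 (Gproj r c).
  move=> rR; have [rsb|rsb] := boolP (r \in sb); last first.
    by apply: uvR; rewrite mem_filter rsb.
  have sgG := Gam_subgroup basis_w (set_val r) 1.
  have powG g : U g -> Gamma r 1 (Gproj r g ^+ m).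
    have /dvdnP[j ->] : (M r %| m)%N.
      by rewrite /m (big_rem r) //= mulnCA dvdn_mulr.
    by move=> Ug; rewrite mulnC expgM; apply: (subgroupX sgG); exact: (MP r).2.
  have GV g : Gamma r 1 g -> Gamma r 1 g^-1 by exact: subgroupV.
  by rewrite /c !GprojM !GprojV !GprojX; do !apply: (subgroupM sgG); auto.
have [B2 [f2 [f2M f2E _]]] := sp_finite_quotient (set_val l) n basis_w.
have f21 : f2 1 = 1 by apply: (mulgI (f2 1)); rewrite -f2M !mulg1.
have f2V g : f2 g^-1 = (f2 g)^-1.
  by apply: (mulgI (f2 g)); rewrite -f2M !mulgV f21.
have f2X g j : f2 (g ^+ j) = f2 g ^+ j.
  by elim: j => [|j IH]; rewrite ?expg0 // !expgS f2M IH.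
set hc := h ^+ m * h' ^+ m * (h ^+ m)^-1 * (h' ^+ m)^-1.
have cE : Gproj l c = emb l hc.
  by rewrite /c /hc !GprojM !GprojV !GprojX uE vE !sp_embM !sp_embV !sp_embX.
have f2c : f2 hc = f2 z.
  rewrite /hc /z !f2M !f2V !f2X.
  by rewrite ((f2E x h).2 hx) ((f2E y h').2 h'y).
have zo : f2 z ^+ (q l ^ k) = 1.
  by rewrite -f2X -f21; apply/esym/f2E; rewrite invg1 mul1g.
pose T := (\prod_(r <- R) q r ^ n)%N.
have coT : coprime (q l ^ k) T.
  rewrite /T big_seq; elim/big_rec: _ => [|r t rR ct]; first exact: coprimen1.
  rewrite coprimeMr ct andbT; apply/coprimeXl/coprimeXr.
  rewrite prime_coprime ?(valP (set_val l)) // dvdn_prime2 ?(valP (set_val _)) //.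
  by apply: contraNneq lR => /val_inj/val_inj->.
pose e := chinese (q l ^ k) T 1 0.
exists (c ^+ e); split; first exact: subgroupX.
  rewrite GprojX cE -sp_embX -sp_embV -sp_embM; apply/(Gam_emb basis_w).
  have : f2 z = f2 (hc ^+ e).
    rewrite f2X f2c -{1}(expg1 (f2 z)); apply/eqP.
    rewrite eq_expg_mod_order; apply/eqP.
    have oz : (#[f2 z] %| q l ^ k)%N by rewrite order_dvdn zo.
    have := chinese_modl coT 1 0 => /(congr1 (fun j => j %% #[f2 z])%N).
    by rewrite !modn_dvdm.
  by move/f2E; rewrite exprSr; exact: cong_mx_dvd.
move=> r rR; have Te : (T %| e)%N.
  by have := chinese_modr coT 1 0; rewrite mod0n => /eqP.
have /dvdnP[j ->] : (q r ^ n %| e)%N.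
  by apply: dvdn_trans Te; rewrite /T (big_rem r) //= dvdn_mulr.
rewrite GprojX mulnC expgM; apply: (subgroupX (Gam_subgroup basis_w _ _)).
by apply: Gamma_pow; exact: c1.
Qed.

(** An [m]-th power of a root element multiplies its parameter by [m], so the commutators provided
    by the hypothesis are those that [roots_of_comm] asks for with [c = m * c0]. *)
Lemma slice_roots m (l : L) (c0 : OZ l) :
  (forall x y : Sp4 (OZ l),
    Uproj l (emb l x) -> Uproj l (emb l y) ->
    (forall n, cong_mx ((q l)%:R ^+ n.+1)%R (x ^+ (q l ^ n.+1))) ->
    (forall n, cong_mx ((q l)%:R ^+ n.+1)%R (y ^+ (q l ^ n.+1))) ->
    commute x [~ x, y] -> commute y [~ x, y] ->
    slice l (x ^+ m * y ^+ m * (x ^+ m)^-1 * (y ^+ m)^-1)) ->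
  (forall r s, Uproj l (emb l (root_elt r (c0 * s)%R))) ->
  forall r s, slice l (root_elt r (2%:R * (m%:R * c0) ^+ 3 * s)%R).
Proof.
move=> commS rootU; have E s : (m%:R * c0 * s = c0 * (m%:R * s))%R by ring.
have rootP r s n : cong_mx ((q l)%:R ^+ n.+1)%R (root_elt r s ^+ (q l ^ n.+1)).
  rewrite -root_eltX -[(s *+ _)%R]mulr_natl natrX.
  exact: cong_mx_root.
apply: roots_of_comm; first exact: slice_subgroup.
  by move=> r s h; apply: slice_conj; rewrite E.
move=> r1 r2 s t r12.
have rE r u : root_elt r (m%:R * c0 * u)%R = root_elt r (c0 * u)%R ^+ m.
  by rewrite -root_eltX -mulrA mulr_natl.
rewrite !rE; have [] := short_pair_commute (c0 * s)%R (c0 * t)%R r12.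
by apply: commS.
Qed.

(** In general only root elements with parameters divisible by a power of [l] are known to lie in
    the projection. At a good [l] all of them do, and if [l] does not divide [2 * m] the constant
    [2 * m ^ 3] is a unit. *)
Lemma slice_open_full : exists m, (0 < m)%N /\ forall l : L,
  (exists k, cong_mx ((q l)%:R ^+ k)%R `<=` slice l) /\
  (~ bad l -> ~~ (q l %| 2 * m)%N -> forall g, slice l g).
Proof.
have [m m0 commS] := slice_comm; exists m; split=> // l.
have pl : prime (q l) := valP (set_val l).
split.
- have [n nU] := Gam_nbhs1 (openU l) (subgroup1 (Uproj_subgroup l)).
  (* With [n.+1] instead of [n], [l] divides [D] even if [n = 0]; elements congruent to 1 modulo [D]
     are then units, which settles the stable range. *)
  pose c0 : OZ l := ((q l)%:R ^+ n.+1)%R.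
  have rootU r s : Uproj l (emb l (root_elt r (c0 * s)%R)).
    apply: nU; apply/(Gam_emb basis_w).
    by rewrite /c0 exprSr -mulrA; exact: cong_mx_root.
  have rootS := slice_roots (commS l) rootU.
  pose D := ((2 * (m * q l ^ n.+1) ^ 3) ^ 2)%N.
  have cD : ((2%:R * (m%:R * c0) ^+ 3) ^+ 2 = D%:R :> OZ l)%R.
    by rewrite /D /c0 !(natrX, natrM).
  have qD : (q l %| D)%N.
    by rewrite /D Euclid_dvdX // Euclid_dvdM // Euclid_dvdX // Euclid_dvdM //
      Euclid_dvdX // dvdnn !orbT.
  have D0 : (0 < D)%N.
    by rewrite /D expn_gt0 muln_gt0 expn_gt0 muln_gt0 m0 expn_gt0 (prime_gt0 pl).
  have gen : cong_mx (D%:R : OZ l)%R `<=` slice l.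
    rewrite -cD; apply: (cong_mx_generated (slice_subgroup l) rootS).
    move=> a b x y [u ->] _ _; rewrite cD.
    have /dvdnP[j DE] := qD; have [s sE] := tens_unit1 basis_w (j%:R * u)%R.
    exists 0%R, s; rewrite mulr0 mul0r addr0 -[RHS]sE DE natrM.
    by congr ((1 + _) * _)%R; ring.
  (* The part [D'] of [D] prime to [l] is a unit of [O (x) Z_l], so the level [D] may be replaced by
     a power of [l]. *)
  have [D' coD' DE] := pfactor_coprime pl D0.
  have [|s sE] := tens_unit_nat basis_w (l := set_val l) (m := D').
    by rewrite coprime_sym.
  exists (logn (q l) D); apply: subset_trans gen => g [W gW].
  exists (s *: W)%R; rewrite gW scalerA; congr (_ + _ *: _)%R.
  by rewrite [X in (X%:R * s)%R]DE natrM natrX mulrAC sE mul1r.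
- move=> good_l q2m.
  have rootU r s : Uproj l (emb l (root_elt r (1 * s)%R)).
    by rewrite Uproj_good //; eexists.
  have rootS := slice_roots (commS l) rootU.
  have [|s sE] := tens_unit_nat basis_w (l := set_val l) (m := (2 * m ^ 3)%N).
    rewrite coprime_sym prime_coprime //; apply: contra q2m.
    by rewrite (Euclid_dvdM _ (m ^ 3)) // Euclid_dvdX // andbT -Euclid_dvdM.
  have cs : ((2%:R * (m%:R * 1) ^+ 3) * s = 1 :> OZ l)%R.
    by rewrite mulr1 -natrX -natrM.
  set c := (2%:R * _)%R in rootS cs.
  have c2 : (c ^+ 2 * s ^+ 2 = 1)%R by rewrite -exprMn cs expr1n.
  move=> g; apply: (cong_mx_generated (slice_subgroup l) rootS); last first.
    exists (s ^+ 2 *: (Sp4_val g - 1%:M))%R.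
    by rewrite scalerA c2 scale1r addrC subrK.
  move=> a b x y _ _ axby; have [t [z tz]] := tens_stable_range basis_w axby.
  by exists (s ^+ 2 * t)%R, z; rewrite mulrA c2 mul1r.
Qed.

(** * From the slices to openness of [U] *)

Lemma finite_prime_divisors k : (0 < k)%N -> finite_set [set l : L | (q l %| k)%N].
Proof.
move=> k0; apply: (@sub_finite_set _ _ ((fun l : L => q l) @^-1` `I_k.+1)).
  by move=> l /= /(dvdn_leq k0); rewrite ltnS.
apply: finite_preimage (finite_II k.+1).
by move=> l r _ _ /val_inj/val_inj.
Qed.

Lemma slice_prod (g : Gadele K L) (s : seq L) : uniq s ->
  (forall l, exists2 h, slice l h & Gproj l g = emb l h) ->
  exists2 u, U u & forall l, Gproj l u = if l \in s then Gproj l g else 1.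
Proof.
move=> + gS; elim: s => [_|l s IH /= /andP[ls /IH[u Uu uE]]].
  by exists 1; [exact: subgroup1 | move=> l; rewrite Gproj1].
have [h [v Uv [vl vr]] gl] := gS l.
exists (u * v); first exact: subgroupM.
move=> r; rewrite GprojM inE; case: eqVneq => [->|rl] /=.
  by rewrite uE (negPf ls) mul1g vl gl.
by rewrite vr ?mulg1 ?uE //; apply/eqP.
Qed.

Lemma closed_open : closed U -> open U.
Proof.
move=> closedU; have [m [m0 Hm]] := slice_open_full.
have /choice[k kP] : forall l : L, exists k,
    cong_mx ((q l)%:R ^+ k)%R `<=` slice l /\
    (~ bad l -> ~~ (q l %| 2 * m)%N -> k = 0%N).
  move=> l; have [[k kS] full] := Hm l.
  have [[bl ql]|bq] := pselect (~ bad l /\ ~~ (q l %| 2 * m)%N).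
    by exists 0%N; split=> // g _; exact: full.
  by exists k; split=> // bl ql; case: bq.
have fin_k : finite_set [set l | bad l \/ k l <> 0%N].
  have : finite_set (bad `|` [set l : L | (q l %| 2 * m)%N]).
    rewrite finite_setU; split; first exact: fullU.
    by apply: finite_prime_divisors; rewrite muln_gt0 m0.
  apply: sub_finite_set => l /= [bl|kl]; first by left.
  have [bl|bl] := pselect (bad l); [by left | right].
  by apply: contrapT => /negP ql; apply: kl; exact: (kP l).2.
(* For [u] in [U] this is a restricted box: at almost all [l] the exponent [k l] is 0 and [u] is
   integral, so the coset is [Gloc_int] itself. *)
pose B (u : Gadele K L) :=
  [set g | forall l, Gamma l (k l) ((Gproj l u)^-1 * Gproj l g)].
have boxB u : U u -> restricted_box (B u).
  move=> Uu; exists (fun l => [set h | Gamma l (k l) ((Gproj l u)^-1 * h)]).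
  split=> //; first by move=> l; exact: (Gam_coset_open basis_w).
  apply: sub_finite_set fin_k => l /= neq; apply: contrapT => /not_orP[bl kl].
  apply: neq; have k0 : k l = 0%N by exact: contrapT.
  have ul : Gamma l 0 (Gproj l u).
    rewrite Gam0 -(Uproj_good bl); by exists u.
  have sgG := Gam_subgroup basis_w (set_val l) 0.
  rewrite -Gam0 k0; apply/seteqP; split=> h /=.
    by move/(subgroupM sgG ul); rewrite mulKVg.
  exact: (subgroupM sgG (subgroupV sgG ul)).
have B1U g : B 1 g -> U g.
  move=> Bg; have gS l : exists2 h, slice l h & Gproj l g = emb l h.
    have [h hk hE] := Bg l; exists h; first exact: (kP l).1.
    by rewrite hE Gproj1 invg1 mul1g.
  have clU : closure U `<=` U by rewrite -(iffLR (closure_id U)).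
  apply: clU; rewrite closureEonbhs => V A VU [oA Ag].
  have [C boxC [Cg CA]] := nbhs_box oA Ag (boxB 1 (subgroup1 sgU)) Bg.
  move: boxC Cg CA => [W [oW /finite_seqP[s sE] ->]] /= Wg CA.
  (* [u] agrees with [g] at the finitely many primes of [s] and is 1 elsewhere, where [W l] is the
     integral group; so [u] lies in the box around [g]. *)
  have [u Uu uE] := slice_prod (undup_uniq s) gS.
  exists u; split; first exact: VU.
  apply: CA => l; rewrite uE mem_undup; case: ifP => [_|/negP ls]; first exact: Wg.
  have -> : W l = Gloc_int K (set_val l).
    apply: contrapT => Wl; apply: ls.
    have : [set l | W l <> Gloc_int K (set_val l)] l by [].
    by rewrite sE.
  rewrite -Gam0; exact: subgroup1 (Gam_subgroup basis_w _ _).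
rewrite openE => u Uu; rewrite /interior nbhsE.
exists (B u); first split.
- by apply: restricted_box_open; exact: boxB.
- by move=> l; rewrite mulVg; exact: subgroup1 (Gam_subgroup basis_w _ _).
move=> g Bg; rewrite -(mulKVg u g); apply: (subgroupM sgU) => //.
by apply: B1U => l; rewrite Gproj1 invg1 mul1g GprojM GprojV; exact: Bg.
Qed.

End Adelic.

Theorem theorem3p13 (R : realType) (N : nat) (a eps : nat -> R[i])
    (E : fieldExtType rat) (iota : {rmorphism E -> R[i]}) (F : {subfield E})
    (eps_char : dirichlet_character N eps)
    (E_def : range iota = coefficient_field N a eps)
    (F_def : forall x : E, x \in F <->
       forall sigma : {rmorphism E -> R[i]},
         inner_twist_group N a iota sigma -> sigma x = iota x)
    (L : set prime_number) (U : set (Gadele (subvs_of F) L))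
    (U_subgroup : is_subgroup U) (U_closed : closed U) (U_compact : compact U)
    (U_open_proj : forall l : L, open (Gproj l @` U))
    (U_full_proj : finite_set
       [set l : L | Gproj l @` U <> Gloc_int (subvs_of F) (set_val l)]) :
  open U.
Proof.
have [d [w [lam bas]]] := int_ring_Zbasis (subvs_of F).
exact: (closed_open bas U_subgroup U_open_proj U_full_proj U_compact U_closed).
Qed.
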